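(* For every integer $k\ge2$, all $p_0<1$, and every $\varepsilon>0$, there exists a constant $L>0$ such that the following holds. Let $n$ be a positive integer and let $p\in(0,1)$ satisfy $Ln^{-1/(k-1)}\le p\le p_0$. Let $X=A_k([n]_p)$. Then, for every $\eta\in[0,1]$, $$(1-\varepsilon)\,\Phi_{n,p}^k(\eta+\varepsilon)\ \le\ -\log\Pr\big(X\le\eta\,\mathbb E[X]\big)\ \le\ (1+\varepsilon)\,\Phi_{n,p}^k\big((1-\varepsilon)\eta\big).$$
   Context: Write $[n]=\{1,\dots,n\}$. For $q:[n]\to[0,1]$, $[n]_q$ is the random subset of $[n]$ obtained by retaining each $i\in[n]$ independently with probability $q_i$; $[n]_p$ is the case $q\equiv p$. For $I\subseteq[n]$, $A_k(I)$ is the number of $k$-term arithmetic progressions in $I$, i.e. of sets $\{x,x+d,\dots,x+(k-1)d\}\subseteq I$ with $d\ge1$ an integer. For $p\in(0,1)$ and $q\in[0,1]$, $$i_p(q)=q\log\frac qp+(1-q)\log\frac{1-q}{1-p},$$ with natural logarithms and $0\log 0=0$. For real $\eta$, $$\Phi_{n,p}^k(\eta)=\min\Big\{\sum_{i\in[n]}i_p(q_i):\ q\in[0,1]^{[n]},\ \mathbb E\big[A_k([n]_q)\big]\le\eta\cdot\mathbb E\big[A_k([n]_p)\big]\Big\},$$ where the minimum over an empty set is $+\infty$. *)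

(* Defs.v *)
From mathcomp Require Import all_boot all_order all_algebra.
From mathcomp Require Import all_classical all_reals all_analysis.

Set Implicit Arguments.
Unset Strict Implicit.
Unset Printing Implicit Defensive.

Import Order.TTheory GRing.Theory Num.Theory.

Local Open Scope ring_scope.

(** The ordinal [i : 'I_n] stands for the integer [i.+1] of
    [[n] = {1, ..., n}]. *)

(** [B = {x, x + d, ..., x + (k-1) d}] as a set of integers, for some [d >= 1]. *)
Definition is_AP (k n : nat) (B : {set 'I_n}) : Prop :=
  exists x d : nat, (0 < d)%N /\
    [seq (val i).+1 | i <- enum B] =i [seq (x + j * d)%N | j <- iota 0 k].

Definition nAP (k n : nat) (I : {set 'I_n}) : nat :=
  #|[set B : {set 'I_n} | (B \subset I) && `[< is_AP k B >]]|.

(** The law of the binomial random subset [[n]_q]: the probability that it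
    equals [S]. *)
Definition binom_law (R : realType) (n : nat) (q : 'I_n -> R)
    (S : {set 'I_n}) : R :=
  \prod_(i < n) (if i \in S then q i else 1 - q i).

Definition Prob (R : realType) (n : nat) (q : 'I_n -> R)
    (P : pred {set 'I_n}) : R :=
  \sum_(S : {set 'I_n} | P S) binom_law q S.

Definition Expect (R : realType) (n : nat) (q : 'I_n -> R)
    (X : {set 'I_n} -> R) : R :=
  \sum_(S : {set 'I_n}) binom_law q S * X S.

(** [E[A_k([n]_q)]]. *)
Definition mean_AP (R : realType) (k n : nat) (q : 'I_n -> R) : R :=
  Expect q (fun S => (nAP k S)%:R).

(** [0 log 0 = 0] holds because the factor in front of the logarithm is [0]. *)
Definition rel_ent (R : realType) (p q : R) : R :=
  q * ln (q / p) + (1 - q) * ln ((1 - q) / (1 - p)).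

(** For [0 < p < 1] the feasible set is compact and the objective is
    continuous on it, so that the infimum is a minimum whenever the feasible
    set is nonempty; [ereal_inf set0 = +oo]. *)
Definition Phi (R : realType) (k n : nat) (p eta : R) : \bar R :=
  ereal_inf [set (\sum_(i < n) rel_ent p (q i))%:E | q in
    [set q : 'I_n -> R | (forall i, 0 <= q i <= 1) /\
      mean_AP k q <= eta * mean_AP k (fun _ : 'I_n => p)]].

(** [Pr(X <= eta E[X])] for [X = A_k([n]_p)].  It is positive when [p < 1],
    as [[n]_p] may be empty when [k > 0], so that its real logarithm is the
    genuine one. *)
Definition lower_tail (R : realType) (k n : nat) (p eta : R) : R :=
  Prob (fun _ : 'I_n => p)
    (fun S => (nAP k S)%:R <= eta * mean_AP k (fun _ : 'I_n => p)).

(* Main.v *)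
Require Import Defs.
From mathcomp Require Import all_boot all_order all_algebra.
From mathcomp Require Import all_classical all_reals all_analysis.
From mathcomp Require Import ring lra.
From mathcomp Require Import fintype finset.

(** Only three features of progressions matter: the sets counted by X form a
k-uniform hypergraph E on [n], two distinct points lie in at most k^2 of its
edges, and it has at least c n^2 edges.  Let N be the number of edges and
m = N p^k the mean of X.  The event D = {X <= eta m} is decreasing.  The lower
bound on p says exactly that n p^(k-1) is large.

Bounding the probability of D from below ([lower_tail_cost_le]).  Let q be
feasible; replacing it by min(q, p) only helps.  By Markov's inequality D has
[n]_q-probability at least eps.  The log-likelihood ratio of [n]_q against [n]_p
has mean sum_i i_p(q_i) and variance O(n p), so Chebyshev's inequality and a
change of measure ([Prob_tilt_ge]) give
Pr_p(D) >= (eps/2) exp(- sum_i i_p(q_i) - a) with a a small multiple of n p.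
Both losses are absorbed in a factor 1 + eps, because a q that lowers the mean
by a constant factor must be smaller than p by order n p in total
([sum_decrease_ge]), so that its cost is itself at least of order n p.

Bounding the probability of D from above ([exists_cheap_density]).  Let Y be
[n]_p conditioned on D, let A be a set of vertices, and let q_v be the
conditional probability that v is in Y given the trace of Y on A.  The chain
rule for relative entropy, in the form of Gibbs' inequality, shows that the mean
of sum_(v notin A) i_p(q_v) is at most - log Pr(D) ([sum_cond_rel_ent_le]).  So q
(with q = p on A) has the right cost on average, and it remains to choose A so
that the mean number of edges of [n]_q is at most E[X(Y) | trace on A] + eps m,
the first term being at most eta m since Y is in D.

For an edge e disjoint from A, the product of the q_v over e is compared with
the conditional probability that e is contained in Y one vertex at a time.  The
error made at v is controlled by the conditional mutual information, given the
trace on A, between the event v in Y and the trace of Y on the rest of e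
([mutual_info_ge], [prod_cprob_le]).  Since D is decreasing, Harris' inequality
bounds the conditional probability of T being contained in Y by p^|T|
([cprob_card_le]), which keeps all errors at the scale p^k.

The information is made small by the choice of A.  The entropy deficit f_v(A)
of v given the trace on A is nondecreasing in A and at most Z p / (1 - p), where
Z = Pr(D), and the mutual information above is f_v(A + (e - v)) - f_v(A).  Take
A random of density alpha.  As f_v is monotone, revealing the k - 1 vertices of
e - v costs at most alpha^-(k-1) times the sum of the costs of revealing them
separately ([influence_union]); by bounded codegree the sum over all edges is at
most a constant times the total influence of sum_v f_v, which by Russo's formula
is its derivative in alpha ([russo]).  The mean value theorem yields an alpha in
(delta, 2 delta) where this derivative is O(n p Z / delta)
([exists_low_influence]).  The accumulated error O(n p) is negligible against
m, of order n^2 p^k, precisely because n p^(k-1) is large, and the edges meeting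
A are few because delta is small. *)

Set Implicit Arguments.
Unset Strict Implicit.
Unset Printing Implicit Defensive.

Import Order.TTheory GRing.Theory Num.Theory.
Import numFieldNormedType.Exports.

Local Open Scope ring_scope.

(** * Expectations over binomial random sets *)

Lemma set_card_ind (T : finType) (P : {set T} -> Prop) :
  P set0 -> (forall (x : T) (X : {set T}), x \notin X -> P X -> P (x |: X)) -> forall X, P X.
Proof.
move=> P0 PS X; have [m] := ubnP #|X|; elim: m X => // m IH X Xm.
have [->//|[x xX]] := set_0Vmem X.
rewrite -(setD1K xX); apply: PS; first by rewrite !inE eqxx.
by apply: IH; move: Xm; rewrite (cardsD1 x X) xX.
Qed.

Section Expectation.
Variables (R : realType) (n : nat).
Implicit Types (q : 'I_n -> R) (S A T : {set 'I_n}) (f g : {set 'I_n} -> R).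

(** Independence of the vertices: the expectation of a product of functions of
single vertices factorises. *)
Lemma Expect_prod q (phi : 'I_n -> bool -> R) :
  Expect q (fun S => \prod_i phi i (i \in S)) =
  \prod_i (q i * phi i true + (1 - q i) * phi i false).
Proof.
transitivity (\prod_(i < n) \sum_(b : bool)
    (if b then q i else 1 - q i) * phi i b); last first.
  by apply: eq_bigr => i _; rewrite big_bool.
rewrite bigA_distr_bigA /= /Expect.
rewrite (reindex (fun S : {set 'I_n} => [ffun i => i \in S])) /=; last first.
  exists (fun f : {ffun 'I_n -> bool} => [set i | f i]) => [S _|f _].
    by apply/setP => i; rewrite inE ffunE.
  by apply/ffunP => i; rewrite ffunE inE.
apply: eq_bigr => S _; rewrite /binom_law -big_split /=.
by apply: eq_bigr => i _; rewrite ffunE.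
Qed.

Lemma eq_Expect q f g : f =1 g -> Expect q f = Expect q g.
Proof. by move=> fg; apply: eq_bigr => S _; rewrite fg. Qed.

Lemma Expect_cst q (c : R) : Expect q (fun=> c) = c.
Proof.
have := Expect_prod q (fun _ _ => 1).
under eq_Expect => S do rewrite big1 //.
rewrite big1 => [|i _]; last by rewrite !mulr1 addrCA subrr addr0.
rewrite /Expect -mulr_suml => e.
by rewrite -[RHS]mul1r -[in RHS]e -mulr_suml mulr1.
Qed.

Lemma Expect_edge q T :
  Expect q (fun S => (T \subset S)%:R) = \prod_(i in T) q i.
Proof.
transitivity (Expect q (fun S => \prod_i ((i \in T) ==> (i \in S))%:R)).
  apply: eq_Expect => S; have [sTS|] := boolP (T \subset S).
    by rewrite big1 // => i _; case: (boolP (i \in T)) => //= /(subsetP sTS) ->.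
  case/subsetPn => i iT iS; rewrite (bigD1 i) //= iT (negbTE iS) mul0r //.
rewrite (Expect_prod q (fun i b => ((i \in T) ==> b)%:R)) [RHS]big_mkcond /=.
apply: eq_bigr => i _; case: (i \in T) => /=; rewrite ?mulr0 !mulr1 ?addr0 //.
by rewrite addrCA subrr addr0.
Qed.

Lemma Expect_sum q (I : Type) (r : seq I) (P : pred I) (F : I -> {set 'I_n} -> R) :
  Expect q (fun S => \sum_(i <- r | P i) F i S) =
  \sum_(i <- r | P i) Expect q (F i).
Proof.
rewrite /Expect exchange_big /=; apply: eq_bigr => S _.
by rewrite mulr_sumr.
Qed.

Lemma ExpectD q f g : Expect q (fun S => f S + g S) = Expect q f + Expect q g.
Proof. by rewrite /Expect -big_split; apply: eq_bigr => S _; rewrite mulrDr. Qed.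

Lemma ExpectB q f g : Expect q (fun S => f S - g S) = Expect q f - Expect q g.
Proof. by rewrite /Expect -sumrB; apply: eq_bigr => S _; rewrite mulrBr. Qed.

Lemma ExpectZ q (c : R) f : Expect q (fun S => c * f S) = c * Expect q f.
Proof. by rewrite /Expect mulr_sumr; apply: eq_bigr => S _; rewrite mulrCA. Qed.

Lemma Expect_pred q (P : pred {set 'I_n}) :
  Expect q (fun S => (P S)%:R) = Prob q P.
Proof.
rewrite /Expect /Prob [RHS]big_mkcond; apply: eq_bigr => S _.
by case: (P S); rewrite ?mulr1 ?mulr0.
Qed.

Definition prob_vec q := forall i, 0 <= q i <= 1.

Lemma binom_law_ge0 q S : prob_vec q -> 0 <= binom_law q S.
Proof.
move=> vq; apply: prodr_ge0 => i _; have /andP[q0 q1] := vq i.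
by case: ifP; rewrite ?subr_ge0.
Qed.

Lemma binom_law_gt0 (p : R) S : 0 < p < 1 -> 0 < binom_law (fun=> p) S.
Proof.
by move=> /andP[p0 p1]; apply: prodr_gt0 => i _; case: ifP; rewrite ?subr_gt0.
Qed.

Lemma le_Expect q f g : prob_vec q -> (forall S, f S <= g S) ->
  Expect q f <= Expect q g.
Proof.
by move=> vq fg; apply: ler_sum => S _; rewrite ler_wpM2l ?binom_law_ge0.
Qed.

Lemma Expect_ge0 q f : prob_vec q -> (forall S, 0 <= f S) -> 0 <= Expect q f.
Proof. by move=> vq f0; rewrite -(Expect_cst q 0); exact: le_Expect. Qed.

Lemma sum_set_split (u : 'I_n) f :
  \sum_S f S = \sum_(S : {set 'I_n} | u \notin S) (f (u |: S) + f S).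
Proof.
rewrite (bigID (fun S : {set 'I_n} => u \in S)) /= big_split /=; congr (_ + _).
rewrite (reindex_onto (fun S => u |: S) (fun S => S :\ u)) /=; last first.
  by move=> S uS; rewrite setD1K.
apply: eq_bigl => S; rewrite setU11 /=; apply/eqP/idP.
  by move<-; rewrite !inE eqxx.
by move=> uS; rewrite setU1K.
Qed.

Definition law_except q u S := \prod_(i < n | i != u) (if i \in S then q i else 1 - q i).

Lemma binom_law_except q u S :
  binom_law q S = (if u \in S then q u else 1 - q u) * law_except q u S.
Proof. by rewrite /binom_law (bigD1 u). Qed.

Lemma law_exceptU q u S : law_except q u (u |: S) = law_except q u S.
Proof. by apply: eq_bigr => i /negbTE iu; rewrite !inE iu. Qed.

Lemma Expect_split q u g :
  Expect q g = \sum_(S : {set 'I_n} | u \notin S)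
    law_except q u S * (q u * g (u |: S) + (1 - q u) * g S).
Proof.
rewrite /Expect (sum_set_split u); apply: eq_bigr => S uS.
rewrite !(binom_law_except q u) setU11 (negbTE uS) law_exceptU; ring.
Qed.

(** Conditioning on a single vertex: Harris' inequality, the bound [Expect_absorb] and
the orthogonality in [variance_le] are all read off this identity. *)
Lemma Expect_coord q u f :
  Expect q f = q u * Expect q (fun S => f (u |: S))
             + (1 - q u) * Expect q (fun S => f (S :\ u)).
Proof.
rewrite !(Expect_split _ u) !mulr_sumr -big_split; apply: eq_bigr => S uS /=.
rewrite setUA setUid setU1K // (_ : S :\ u = S); first by ring.
by apply/setP => i; rewrite !inE; case: eqVneq => // ->; rewrite (negbTE uS).
Qed.

(** A random set of density a contains u with probability a, so forcing u into it
multiplies the mean of a nonnegative function by at most 1/a. *)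
Lemma Expect_absorb (a : R) u f : 0 < a <= 1 -> (forall S, 0 <= f S) ->
  Expect (fun=> a) (fun S => f (u |: S)) <= a^-1 * Expect (fun=> a) f.
Proof.
move=> /andP[a0 a1] f0; rewrite ler_pdivlMl //.
rewrite [leRHS](Expect_coord _ u) lerDl mulr_ge0 ?subr_ge0 //.
by apply: Expect_ge0 => // i; rewrite a1 ltW.
Qed.

End Expectation.

(** * Inequalities for relative entropy and mutual information *)

Section Entropy.
Variable R : realType.
Implicit Types p q t x y : R.

Lemma ln_le_sub1 x : 0 < x -> ln x <= x - 1.
Proof.
by move=> x0; rewrite -{1}(subrKC 1 x); apply: le_ln1Dx; lra.
Qed.

Lemma ln1B_ge t : 0 <= t <= 2^-1 -> - t - 2 * t ^+ 2 <= ln (1 - t).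
Proof.
move=> /andP[t0 t2]; have h : 0 < 1 - t by lra.
have := @ln_le_sub1 (1 - t)^-1; rewrite lnV ?posrE // invr_gt0 => /(_ h) e.
suff : (1 - t)^-1 <= 1 + t + 2 * t ^+ 2 by lra.
rewrite -[_^-1]mul1r ler_pdivrMr //.
have : 0 <= t ^+ 2 * (1 - 2 * t) by rewrite mulr_ge0 ?exprn_ge0 //; lra.
by rewrite !expr2; lra.
Qed.

(** The pointwise form of the log-sum inequality: ln r >= 1 - 1/r at r = x / y. *)
Lemma xlnx_ratio_ge x y : 0 <= x -> 0 <= y -> (y = 0 -> x = 0) ->
  x - y <= x * ln (x / y).
Proof.
move=> x0 y0 yx; have [->|x_neq0] := eqVneq x 0; first by rewrite mul0r; lra.
have xp : 0 < x by rewrite lt_def x_neq0.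
have yp : 0 < y by rewrite lt_def y0 andbT; apply: contra_neq x_neq0.
have := @ln_le_sub1 (y / x); rewrite divr_gt0 // => /(_ isT) h.
have -> : x - y = x * (1 - y / x) by field.
rewrite ler_pM2l // -[x / y]invf_div lnV ?posrE ?divr_gt0 //; lra.
Qed.

(** Linearised form of the quadratic lower bound on relative entropy: comparing q
with p (1 - t) instead of p costs only q ln (1 - t).  Taking t proportional to
(p - q) / p recovers the order (p - q)^2 / p. *)
Lemma rel_ent_lb p q t : 0 < p < 1 -> 0 <= q <= 1 -> 0 <= t <= 2^-1 ->
  t * (p - q) - 2 * t ^+ 2 * q <= rel_ent p q.
Proof.
move=> /andP[p0 p1] /andP[q0 q1] ht; have /andP[t0 t2] := ht.
have t1 : 0 < 1 - t by lra.
have h1 : q - p * (1 - t) <= q * ln (q / (p * (1 - t))).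
  apply: xlnx_ratio_ge; rewrite ?mulr_ge0 ?(ltW t1) ?(ltW p0) // => /eqP.
  by rewrite mulf_eq0 !gt_eqF.
have h2 : (1 - q) - (1 - p) <= (1 - q) * ln ((1 - q) / (1 - p)).
  by apply: xlnx_ratio_ge; lra.
have h3 : q * ln (q / p) = q * ln (q / (p * (1 - t))) + q * ln (1 - t).
  have [->|q_neq0] := eqVneq q 0; first by rewrite !mul0r addr0.
  have qp : 0 < q by rewrite lt_def q_neq0.
  rewrite -mulrDr -lnM ?posrE ?divr_gt0 ?mulr_gt0 //; congr (_ * ln _).
  by field; rewrite !gt_eqF.
have h4 : q * (- t - 2 * t ^+ 2) <= q * ln (1 - t).
  by rewrite ler_wpM2l // ln1B_ge.
by rewrite /rel_ent h3; lra.
Qed.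

Lemma rel_ent_ge0 p q : 0 < p < 1 -> 0 <= q <= 1 -> 0 <= rel_ent p q.
Proof.
move=> hp hq; have := rel_ent_lb (t := 0) hp hq.
rewrite lexx invr_ge0 ler0n => /(_ isT).
by rewrite mul0r expr0n /= mulr0 mul0r subr0.
Qed.

Lemma rel_ent_refl p : 0 < p < 1 -> rel_ent p p = 0.
Proof.
move=> /andP[p0 p1]; rewrite /rel_ent !divff ?gt_eqF ?subr_gt0 // ln1.
by rewrite !mulr0 addr0.
Qed.

End Entropy.

Section MutualInformation.
Variables (R : realType) (Omega F1 F2 : finType) (mu : Omega -> R).
Variables (Y : Omega -> F1) (U : Omega -> F2).
Hypothesis mu_ge0 : forall w, 0 <= mu w.

Definition mass (P : pred Omega) : R := \sum_(w | P w) mu w.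

Lemma mass_ge0 P : 0 <= mass P.
Proof. by apply: sumr_ge0. Qed.

Lemma mass_le (P Q : pred Omega) : (forall w, P w -> Q w) -> mass P <= mass Q.
Proof.
move=> PQ; rewrite /mass [leRHS](bigID P) /= -[leLHS]addr0 lerD ?sumr_ge0 //.
rewrite le_eqVlt; apply/orP; left; apply/eqP/eq_bigl => w.
by case: (boolP (P w)) => [/PQ ->|_]; rewrite ?andbF.
Qed.

Lemma mass_gt0 (P : pred Omega) w : P w -> 0 < mu w -> 0 < mass P.
Proof.
move=> Pw mw; rewrite /mass (bigD1 w) //= ltr_pwDl // sumr_ge0 //.
Qed.

Lemma mass_partition (I : finType) (V : Omega -> I) (P : pred I) :
  mass (fun w => P (V w)) = \sum_(i | P i) mass (fun w => V w == i).
Proof.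
rewrite /mass (partition_big V P) //=; apply: eq_bigr => i Pi.
by apply: eq_bigl => w; case: eqVneq => [->|]; rewrite ?Pi ?andbF.
Qed.

(** The log-sum inequality applied to the joint masses of (Y, U) against the product
of the marginal masses, the latter lowered by the factor 1 - t on the rectangle
F x G.  It turns small mutual information into approximate independence of the
events F(Y) and G(U), in the direction where their joint mass is too small, and
loses only second order terms in t. *)
Lemma mutual_info_ge (F : pred F1) (G : pred F2) (t : R) :
  0 < mass xpredT -> 0 <= t < 1 ->
  t * (mass (fun w => F (Y w)) * mass (fun w => G (U w)) / mass xpredT)
   + ln (1 - t) * mass (fun w => F (Y w) && G (U w))
  <= \sum_w mu w * ln (mass (fun w' => (Y w' == Y w) && (U w' == U w))
       * mass xpredT
       / (mass (fun w' => Y w' == Y w) * mass (fun w' => U w' == U w))).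
Proof.
move=> M0 /andP[t0 t1]; set M := mass xpredT.
pose mY y := mass (fun w => Y w == y); pose mU u := mass (fun w => U w == u).
pose W w := (Y w, U w).
pose a z := mass (fun w => W w == z).
pose b z := mY z.1 * mU z.2 / M.
pose FG z := F z.1 && G z.2.
have aE w : mass (fun w' => (Y w' == Y w) && (U w' == U w)) = a (W w) by [].
have b0 z : 0 <= b z by rewrite /b divr_ge0 ?mulr_ge0 ?mass_ge0.
have -> : \sum_w mu w * ln (mass (fun w' => (Y w' == Y w) && (U w' == U w))
     * M / (mass (fun w' => Y w' == Y w) * mass (fun w' => U w' == U w)))
   = \sum_z a z * ln (a z / b z).
  rewrite (partition_big W xpredT) //=; apply: eq_bigr => z _.
  rewrite /a /mass mulr_suml; apply: eq_bigr => w /eqP <-.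
  by congr (_ * ln _); rewrite /b invf_div mulrA.
have key z : a z - b z + (if FG z then t * b z + ln (1 - t) * a z else 0)
    <= a z * ln (a z / b z).
  have a0 : 0 <= a z by apply: mass_ge0.
  have ba : b z = 0 -> a z = 0.
    move/eqP; rewrite /b mulf_eq0 invr_eq0 (gt_eqF M0) orbF mulf_eq0 => h.
    apply/eqP; rewrite eq_le a0 andbT; case/orP: h => /eqP <-.
      by apply: mass_le => w /eqP <-.
    by apply: mass_le => w /eqP <-.
  case: ifP => _; last by rewrite addr0; apply: xlnx_ratio_ge.
  have h : a z - b z * (1 - t) <= a z * ln (a z / (b z * (1 - t))).
    apply: xlnx_ratio_ge => //; first by rewrite mulr_ge0 // subr_ge0 ltW.
    by move/eqP; rewrite mulf_eq0 subr_eq0 (gt_eqF t1) orbF => /eqP /ba.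
  suff -> : a z * ln (a z / b z) =
      a z * ln (a z / (b z * (1 - t))) + ln (1 - t) * a z by lra.
  have [->|az] := eqVneq (a z) 0; first by rewrite !mul0r mulr0 addr0.
  have ap : 0 < a z by rewrite lt_def az.
  have bp : 0 < b z by rewrite lt_def b0 andbT; apply: contra_neq az.
  clear -ap bp t1; move: (a z) (b z) ap bp => x y x0 y0.
  have t1' : 0 < 1 - t by rewrite subr_gt0.
  rewrite [ln (1 - t) * _]mulrC -mulrDr -lnM ?posrE ?divr_gt0 ?mulr_gt0 //.
  by congr (_ * ln _); field; rewrite !gt_eqF.
have bsum (P : pred F1) (Q : pred F2) :
    \sum_(z | P z.1 && Q z.2) b z
    = mass (fun w => P (Y w)) * mass (fun w => Q (U w)) / M.
  rewrite !mass_partition.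
  rewrite -(pair_big P Q (fun y u => mY y * mU u / M)) /=.
  by rewrite big_distrlr /= mulr_suml; apply: eq_bigr => y _; rewrite mulr_suml.
apply: le_trans (ler_sum _ (fun z _ => key z)).
rewrite big_split /= sumrB -big_mkcond big_split /= -!mulr_sumr.
rewrite -(mass_partition W xpredT) -(mass_partition W FG) -/M.
rewrite (bsum F G) (bsum xpredT xpredT) -/M.
by rewrite mulfK ?gt_eqF // subrr add0r.
Qed.

End MutualInformation.

(** * Conditioning on the trace of a random set *)

Section Conditioning.
Variables (R : realType) (n : nat) (mu : {set 'I_n} -> R).
Implicit Types (S A B T V : {set 'I_n}) (g F : {set 'I_n} -> R) (v : 'I_n).
Hypothesis mu_ge0 : forall S, 0 <= mu S.

(** The mass of the sets with the same trace on A as S.  Conditional quantities are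
functions of a sample S rather than of its trace: this avoids indexing by subsets
of A, and every class of positive mass is reached by some S. *)
Definition atom A S := mass mu (fun S' => S' :&: A == S :&: A).

(** Conditional expectation given the trace on A; it is 0 on null classes. *)
Definition cexp A g S :=
  (\sum_(S' | S' :&: A == S :&: A) mu S' * g S') / atom A S.

Definition cprob A T S := cexp A (fun S' => (T \subset S')%:R) S.

Lemma atom_ge0 A S : 0 <= atom A S.
Proof. exact: mass_ge0. Qed.

Lemma atom_gt0 A S : 0 < mu S -> 0 < atom A S.
Proof. by move=> h; apply: (@mass_gt0 _ _ mu mu_ge0 _ S). Qed.

Lemma atom_eq A S S' : S' :&: A = S :&: A -> atom A S' = atom A S.
Proof. by rewrite /atom => ->. Qed.

Lemma cexp_eq A g S S' : S' :&: A = S :&: A -> cexp A g S' = cexp A g S.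
Proof. by rewrite /cexp /atom => ->. Qed.

Lemma mu_cases S : mu S = 0 \/ 0 < mu S.
Proof. by have := mu_ge0 S; rewrite le_eqVlt => /orP[/eqP <-|]; [left|right]. Qed.

Lemma cexp_tower A g F : (forall S S', S' :&: A = S :&: A -> F S' = F S) ->
  \sum_S mu S * (cexp A g S * F S) = \sum_S mu S * (g S * F S).
Proof.
move=> hF.
transitivity (\sum_S \sum_(S' | S' :&: A == S :&: A)
    mu S' * g S' * F S' * (mu S / atom A S')).
  apply: eq_bigr => S _; rewrite /cexp !mulr_suml mulr_sumr.
  apply: eq_bigr => S' /eqP e; rewrite (hF _ _ e) (atom_eq e); ring.
under eq_bigr => S _ do rewrite big_mkcond.
rewrite exchange_big /=; apply: eq_bigr => S _; rewrite -big_mkcond /=.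
have [->|m0] := mu_cases S; first by rewrite !mul0r big1 // => S' _; rewrite !mul0r.
rewrite -mulr_sumr -mulr_suml.
rewrite (eq_bigl (fun S' => S' :&: A == S :&: A)); last by move=> S'; rewrite eq_sym.
by rewrite -/(atom A S) divff ?gt_eqF ?atom_gt0 // mulr1 mulrA.
Qed.

Lemma cexp_tower1 A g : \sum_S mu S * cexp A g S = \sum_S mu S * g S.
Proof.
have := @cexp_tower A g (fun=> 1) (fun _ _ _ => erefl).
by under eq_bigr do rewrite mulr1; under [in RHS]eq_bigr do rewrite mulr1.
Qed.

Lemma cexp_le A g F S : 0 < mu S -> (forall S', S' :&: A = S :&: A -> 0 < mu S' -> g S' <= F S') ->
  cexp A g S <= cexp A F S.
Proof.
move=> mS gF; rewrite /cexp ler_pM2r ?invr_gt0 ?atom_gt0 //.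
apply: ler_sum => S' /eqP e; have [->|m0] := mu_cases S'; first by rewrite !mul0r.
by rewrite ler_pM2l ?gF.
Qed.

Lemma cexp_cst A (c : R) S : 0 < mu S -> cexp A (fun=> c) S = c.
Proof.
move=> mS; rewrite /cexp -mulr_suml -/(atom A S) mulrC mulrA mulVf ?mul1r //.
by rewrite gt_eqF ?atom_gt0.
Qed.

Lemma cexp_sum A (I : Type) (r : seq I) (P : pred I) (G : I -> {set 'I_n} -> R) S :
  cexp A (fun S' => \sum_(i <- r | P i) G i S') S = \sum_(i <- r | P i) cexp A (G i) S.
Proof.
rewrite /cexp -mulr_suml exchange_big /=; congr (_ / _).
by apply: eq_bigr => S' _; rewrite mulr_sumr.
Qed.

Lemma cprob_ge0 A T S : 0 <= cprob A T S.
Proof.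
by rewrite divr_ge0 ?atom_ge0 // sumr_ge0 // => S' _; rewrite mulr_ge0.
Qed.

Lemma cprob_le1 A T S : cprob A T S <= 1.
Proof.
have := atom_ge0 A S; rewrite le_eqVlt => /orP[/eqP a0|a0].
  by rewrite /cprob /cexp -a0 invr0 mulr0.
rewrite ler_pdivrMr // mul1r; apply: ler_sum => S' _.
by rewrite ler_piMr //; case: (T \subset S').
Qed.

(** Mutual information between the traces on T and on V under the conditional law
given that the trace on A is that of the argument. *)
Definition cmi A T V := cexp A (fun S =>
  ln (atom (A :|: T :|: V) S * atom A S / (atom (A :|: T) S * atom (A :|: V) S))).

Lemma setIU_eq S S' A B :
  (S' :&: (A :|: B) == S :&: (A :|: B)) = (S' :&: A == S :&: A) && (S' :&: B == S :&: B).
Proof.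
apply/eqP/andP => [e|[/eqP a /eqP b]]; last by rewrite !setIUr a b.
split; apply/eqP; apply/setP => i; move/setP: e => /(_ i); rewrite !inE.
  by case: (i \in A); rewrite ?andbF.
by case: (i \in B); rewrite ?andbF ?orbT.
Qed.

(** [mutual_info_ge] for the measure restricted to one class of the trace on A. *)
Lemma cmi_ge A T V T0 V0 S (t : R) : 0 < mu S -> T0 \subset T -> V0 \subset V ->
  0 <= t < 1 ->
  t * (cprob A T0 S * cprob A V0 S) + ln (1 - t) * cprob A (T0 :|: V0) S <= cmi A T V S.
Proof.
move=> mS sT sV ht.
pose nu S' := if S' :&: A == S :&: A then mu S' else 0.
have nu0 S' : 0 <= nu S' by rewrite /nu; case: ifP.
have massE (P : pred {set 'I_n}) :
    mass nu P = \sum_(S' | S' :&: A == S :&: A) mu S' * (P S')%:R.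
  rewrite /mass /nu big_mkcond [RHS]big_mkcond; apply: eq_bigr => S' _.
  by case: (P S'); case: ifP; rewrite ?mulr1 ?mulr0.
have aS := atom_gt0 A mS.
have massT : mass nu xpredT = atom A S.
  by rewrite massE; under eq_bigr do rewrite mulr1.
have := @mutual_info_ge R _ _ _ nu (fun S' => S' :&: T) (fun S' => S' :&: V) nu0
  (fun y => T0 \subset y) (fun u => V0 \subset u) t.
rewrite massT => /(_ aS ht).
have sI (W W0 S' : {set 'I_n}) : W0 \subset W -> (W0 \subset S' :&: W) = (W0 \subset S').
  by move=> sW; rewrite subsetI sW andbT.
have cprobE W : cprob A W S = mass nu (fun S' => W \subset S') / atom A S.
  by rewrite massE.
have e1 : mass nu (fun S' => T0 \subset S' :&: T) = cprob A T0 S * atom A S.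
  rewrite cprobE divfK ?gt_eqF //; apply: eq_bigl => S'; exact: sI.
have e2 : mass nu (fun S' => V0 \subset S' :&: V) = cprob A V0 S * atom A S.
  rewrite cprobE divfK ?gt_eqF //; apply: eq_bigl => S'; exact: sI.
have e3 : mass nu (fun S' => (T0 \subset S' :&: T) && (V0 \subset S' :&: V))
    = cprob A (T0 :|: V0) S * atom A S.
  rewrite cprobE divfK ?gt_eqF //; apply: eq_bigl => S'; rewrite !sI //.
  by rewrite subUset.
rewrite e1 e2 e3.
set lhs := (X in X <= _ -> _); set rhs := (X in _ <= X -> _).
have -> : lhs = (t * (cprob A T0 S * cprob A V0 S) + ln (1 - t) * cprob A (T0 :|: V0) S) * atom A S.
  by rewrite /lhs; field; rewrite gt_eqF.
suff -> : rhs = cmi A T V S * atom A S by rewrite ler_pM2r.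
rewrite /cmi /cexp divfK ?gt_eqF // /rhs [RHS]big_mkcond.
apply: eq_bigr => S' _; rewrite {1}/nu; case: eqP => e; last by rewrite mul0r.
have massA W : mass nu (fun S'' => S'' :&: W == S' :&: W) = atom (A :|: W) S'.
  rewrite /mass /atom /mass big_mkcond [RHS]big_mkcond; apply: eq_bigr => S'' _.
  by rewrite /nu setIU_eq e; case: (S'' :&: A == _); case: (S'' :&: W == _).
rewrite !massA -(atom_eq e); congr (_ * ln (_ * _ / _)).
rewrite -setUA -massA; apply: eq_bigl => S''.
by rewrite setIU_eq.
Qed.

Lemma cmi_ge0 A T V S : 0 < mu S -> 0 <= cmi A T V S.
Proof.
move=> mS; have := @cmi_ge A T V set0 set0 S 0 mS (sub0set _) (sub0set _).
by rewrite lexx ltr01 => /(_ isT); rewrite subr0 ln1 !mul0r addr0.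
Qed.

(** The relative entropy of the membership of v with respect to a Bernoulli(p)
variable, conditionally on the trace on A - v and weighted by mu.  Removing v
from A keeps this monotone in A for every A, and the reference p cancels from
its increments. *)
Definition deficit (p : R) v A := \sum_S mu S *
  ln (atom (v |: A) S / atom (A :\ v) S / (if v \in S then p else 1 - p)).

(** The chain rule for entropy. *)
Lemma sum_cmi (p : R) v A T : 0 < p < 1 -> v \notin A -> v \notin T ->
  \sum_S mu S * cmi A T [set v] S = deficit p v (A :|: T) - deficit p v A.
Proof.
move=> /andP[p0 p1] vA vT; rewrite cexp_tower1 -sumrB; apply: eq_bigr => S _.
have [->|mS] := mu_cases S; first by rewrite !mul0r subr0.
rewrite -mulrBr; congr (_ * _).
have rem (W : {set 'I_n}) : v \notin W -> W :\ v = W.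
  move=> vW; apply/setP => i; rewrite !inE; case: eqVneq => // ->.
  by rewrite (negbTE vW).
rewrite !rem ?inE ?negb_or ?vA // [A :|: [set v]]setUC [_ :|: _ :|: [set v]]setUC.
have b0 : 0 < (if v \in S then p else 1 - p) by case: ifP; rewrite ?subr_gt0.
move: (atom_gt0 (v |: (A :|: T)) mS) (atom_gt0 A mS)
  (atom_gt0 (A :|: T) mS) (atom_gt0 (v |: A) mS) b0.
move: (atom _ S) (atom _ S) (atom _ S) (atom _ S) (if _ then _ else _) => a b c d e.
move=> a0 b0 c0 d0 e0.
rewrite !ln_div ?lnM ?posrE ?divr_gt0 ?mulr_gt0 //; ring.
Qed.

Lemma deficitD1 p v A : deficit p v (A :\ v) = deficit p v A.
Proof.
apply: eq_bigr => S _; congr (_ * ln (_ / _ / _)).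
  by congr (atom _ _); apply/setP => i; rewrite !inE; case: eqVneq.
by congr (atom _ _); apply/setP => i; rewrite !inE; case: eqVneq.
Qed.

Lemma deficit_mono p v A B : 0 < p < 1 -> A \subset B ->
  deficit p v A <= deficit p v B.
Proof.
move=> hp sAB; rewrite -(deficitD1 p v A) -(deficitD1 p v B).
have <- : (A :\ v) :|: (B :\ v) = B :\ v.
  by apply/setUidPr; apply: setSD.
rewrite -subr_ge0 -sum_cmi ?inE ?eqxx //; apply: sumr_ge0 => S _.
have [->|mS] := mu_cases S; first by rewrite mul0r.
by rewrite mulr_ge0 ?cmi_ge0.
Qed.

Lemma deficit_ge0 p v A : 0 < p < 1 -> 0 <= deficit p v A.
Proof.
move=> hp; have /andP[p0 p1] := hp.
apply: le_trans (deficit_mono v hp (sub0set A)).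
pose Z := mass mu xpredT; pose m b := mass mu (fun S => (v \in S) == b).
pose be b := if b then p else 1 - p.
have m0 b : 0 <= m b by exact: mass_ge0.
have be0 b : 0 < be b by rewrite /be; case: b; rewrite ?subr_gt0.
have ZE : Z = m true + m false.
  by rewrite /Z (mass_partition mu (fun S => v \in S) xpredT) big_bool.
have atv S : atom (v |: set0) S = m (v \in S).
  apply: eq_bigl => S'; rewrite setU0; apply/eqP/eqP => [/setP/(_ v)|e].
    by rewrite !inE eqxx !andbT.
  by apply/setP => i; rewrite !inE; case: eqVneq => [->|]; rewrite ?andbF ?andbT.
have at0 S : atom (set0 :\ v) S = Z.
  by apply: eq_bigl => S'; rewrite set0D !setI0 eqxx.
have -> : deficit p v set0 = \sum_(b : bool) m b * ln (m b / Z / be b).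
  rewrite /deficit (partition_big (fun S => v \in S) xpredT) //=.
  apply: eq_bigr => b _; rewrite [m b in RHS]/m /mass mulr_suml.
  by apply: eq_bigr => S /eqP <-; rewrite atv at0.
have [Z0|Z0] : Z = 0 \/ 0 < Z.
  have : 0 <= Z by exact: mass_ge0.
  by rewrite le_eqVlt => /orP[/eqP <-|]; [left|right].
  suff mb b : m b = 0 by rewrite big1 // => b _; rewrite mb mul0r.
  by move: ZE (m0 true) (m0 false); rewrite Z0; case: b => ? ? ?; lra.
have h b : m b - Z * be b <= m b * ln (m b / Z / be b).
  rewrite -mulrA -invfM; apply: xlnx_ratio_ge => //; first by rewrite mulr_ge0 ?ltW.
  by move/eqP; rewrite mulf_eq0 !gt_eqF.
apply: le_trans (ler_sum _ (fun b _ => h b)).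
by rewrite big_bool /be /=; rewrite {1 2}ZE; lra.
Qed.

End Conditioning.

(** * A binomial random set conditioned on a decreasing event *)

Section DownSet.
Variables (R : realType) (n : nat) (p : R) (D : pred {set 'I_n}).
Implicit Types (S A B T V e : {set 'I_n}) (v : 'I_n).
Hypothesis hp : 0 < p < 1.
Hypothesis D_down : forall S T, S \subset T -> D T -> D S.

Definition law_on S := if D S then binom_law (fun=> p) S else 0.
Local Notation mu := law_on.

Lemma law_on_ge0 S : 0 <= mu S.
Proof. by rewrite /law_on; case: ifP => // _; apply/ltW/binom_law_gt0. Qed.
Local Notation mu0 := law_on_ge0.

Lemma law_on_gt0 S : (0 < mu S) = D S.
Proof. by rewrite /law_on; case: ifP => _; rewrite ?ltxx ?binom_law_gt0. Qed.

Lemma mass_law_on : mass mu xpredT = Prob (fun=> p) D.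
Proof. by rewrite /mass /law_on /Prob -big_mkcond. Qed.

Let hp' : prob_vec (fun _ : 'I_n => p).
Proof. by move=> _; have /andP[/ltW -> /ltW ->] := hp. Qed.

Lemma cprob_numE A T S :
  \sum_(S' | S' :&: A == S :&: A) mu S' * (T \subset S')%:R
  = Expect (fun=> p) (fun S' => [&& D S', S' :&: A == S :&: A & T \subset S']%:R).
Proof.
rewrite /Expect big_mkcond; apply: eq_bigr => S' _; rewrite /law_on.
by case: (D S'); case: (_ == _); rewrite /= ?mul0r ?mulr0.
Qed.

(** Harris' inequality in the form needed here: D being decreasing, adding v to a
set can only take it out of D, so that conditionally on the trace on A, on D and
on T being contained in the set, v is present with probability at most p. *)
Lemma cprob_setU1_le A T v S : v \notin A -> v \notin T -> 0 < mu S ->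
  cprob mu A (v |: T) S <= p * cprob mu A T S.
Proof.
move=> vA vT mS; have /andP[p0 p1] := hp.
rewrite /cprob /cexp mulrA ler_pM2r ?invr_gt0 ?(atom_gt0 mu0) //.
rewrite !cprob_numE.
set h := fun S' => [&& D S', S' :&: A == S :&: A & T \subset S'].
have -> : Expect (fun=> p) (fun S' => [&& D S', S' :&: A == S :&: A & v |: T \subset S']%:R)
    = p * Expect (fun=> p) (fun S' => (h (v |: S'))%:R).
  rewrite (Expect_coord _ v) [X in _ + _ * X](_ : _ = 0); last first.
    rewrite -[RHS](Expect_cst (fun _ : 'I_n => p) 0); apply: eq_Expect => S'.
    by rewrite subUset sub1set !inE eqxx /= !andbF.
  rewrite mulr0 addr0; congr (_ * _); apply: eq_Expect => S'.
  by rewrite /h subUset sub1set setU11.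
rewrite ler_pM2l // [leRHS](Expect_coord _ v).
have : Expect (fun=> p) (fun S' => (h (v |: S'))%:R)
    <= Expect (fun=> p) (fun S' => (h (S' :\ v))%:R) :> R.
  apply: le_Expect => // S'; rewrite ler_nat.
  case: (boolP (h (v |: S'))) => // /and3P[d e t].
  rewrite /h (D_down _ d) /=; last first.
    by apply: (subset_trans (subsetDl _ _)); apply: subsetUr.
  rewrite lt0b; apply/andP; split.
    rewrite -(eqP e); apply/eqP/setP => i; rewrite !inE.
    by case: eqVneq => // ->; rewrite (negbTE vA) !andbF.
  apply/subsetP => i iT; move/subsetP/(_ _ iT): t; rewrite !inE.
  by case: eqVneq => // ei; rewrite -ei iT in vT.
move=> hle.
by have := ler_wpM2l (x := 1 - p); rewrite subr_ge0 ltW // => /(_ isT _ _ hle); lra.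
Qed.

Lemma cprob_set0 A S : 0 < mu S -> cprob mu A set0 S = 1.
Proof.
move=> mS; rewrite -[RHS](cexp_cst mu0 A _ mS); congr (_ / _).
by apply: eq_bigr => S' _; rewrite sub0set.
Qed.

Lemma cprob1_le A v S : v \notin A -> 0 < mu S -> cprob mu A [set v] S <= p.
Proof.
move=> vA mS; have := @cprob_setU1_le A set0 v S vA; rewrite inE => /(_ isT mS).
by rewrite setU0 cprob_set0 // mulr1.
Qed.

Lemma cprob_card_le A T S : [disjoint T & A] -> 0 < mu S ->
  cprob mu A T S <= p ^+ #|T|.
Proof.
have /andP[p0 p1] := hp.
move=> + mS; elim/set_card_ind: T => [_|v T vT IH].
  by rewrite cprob_set0 // cards0.
rewrite disjoints_subset subUset -(disjoints_subset T) => /andP[vA TA].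
rewrite cardsU1 vT exprS; apply: (le_trans (cprob_setU1_le _ vT mS)).
  by move: vA; rewrite sub1set inE.
by rewrite ler_pM2l // IH.
Qed.

(** The vertices of e are added one at a time to a set T, and [cmi_ge] compares
q_v P(T | A) with P(v + T | A).  The information is taken with the whole of e - v
at each step, since then it does not depend on the order of the vertices. *)
Lemma prod_cprob_le A e S (t : R) : [disjoint e & A] -> 0 < mu S -> 0 < t <= 2^-1 ->
  \prod_(v in e) cprob mu A [set v] S <=
    cprob mu A e S + \sum_(v in e) cmi mu A (e :\ v) [set v] S / t
    + 2 * t * #|e|%:R * p ^+ #|e|.
Proof.
move=> eA mS /andP[t0 t2]; have /andP[p0 p1] := hp.
suff H T : T \subset e -> \prod_(v in T) cprob mu A [set v] S <=
    cprob mu A T S + \sum_(v in T) cmi mu A (e :\ v) [set v] S / t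
    + 2 * t * #|T|%:R * p ^+ #|T| by exact: H.
elim/set_card_ind: T => [_|v T vT IH].
  by rewrite !big_set0 cprob_set0 // cards0 mulr0 mul0r !addr0.
rewrite subUset sub1set => /andP[ve Te]; have {}IH := IH Te.
have vA : v \notin A by move: eA; rewrite disjoints_subset => /subsetP/(_ v ve); rewrite inE.
rewrite !big_setU1 //= cardsU1 vT.
set q := cprob mu A [set v] S.
have q0 : 0 <= q by apply: cprob_ge0 => //; exact: mu0.
have q1 : q <= p by exact: cprob1_le.
set K := \sum_(u in T) cmi mu A (e :\ u) [set u] S / t in IH *.
have K0 : 0 <= K by apply: sumr_ge0 => i _; rewrite divr_ge0 ?(ltW t0) ?(cmi_ge0 mu0).
have pT0 : 0 <= p ^+ #|T| by rewrite exprn_ge0 // ltW.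
set c := cprob mu A (v |: T) S.
have c1 : c <= p ^+ (#|T|.+1).
  have := @cprob_card_le A (v |: T) S; rewrite cardsU1 vT; apply => //.
  rewrite disjoints_subset subUset sub1set inE vA -(disjoints_subset T).
  by apply: disjointWl eA.
have c0 : 0 <= c by apply: cprob_ge0 => //; exact: mu0.
have mi := @cmi_ge _ _ mu mu0 A (e :\ v) [set v] T [set v] S t mS.
have {mi} : t * (cprob mu A T S * q) + ln (1 - t) * c <= cmi mu A (e :\ v) [set v] S.
  rewrite /c setUC; apply: mi => //; last lra.
  by apply/subsetP => i iT; rewrite !inE (subsetP Te) // andbT; apply: contraNneq vT => <-.
set kap := cmi _ _ _ _ _ => mi.
have ln_t : - t - 2 * t ^+ 2 <= ln (1 - t) by apply: ln1B_ge; lra.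
have step : q * cprob mu A T S <= c + kap / t + 2 * t * c.
  rewrite -(ler_pM2l t0).
  have -> : t * (c + kap / t + 2 * t * c) = kap - (- t - 2 * t ^+ 2) * c.
    by field; rewrite gt_eqF.
  have := ler_wpM2r c0 ln_t; lra.
apply: le_trans (ler_wpM2l q0 IH) _.
rewrite !mulrDr.
have h1 : q * K <= K by rewrite ler_piMl //; lra.
have h2 : q * (2 * t * #|T|%:R * p ^+ #|T|) <= 2 * t * #|T|%:R * p ^+ (#|T|.+1).
  rewrite exprS [p * _]mulrC [leRHS]mulrA mulrC ler_wpM2l //.
  by rewrite !mulr_ge0 ?ler0n ?(ltW t0).
have h3 : 2 * t * c <= 2 * t * p ^+ (#|T|.+1) by rewrite ler_wpM2l //; lra.
rewrite natrD mulrDr mulr1 [(_ + _) * p ^+ _]mulrDl; lra.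
Qed.

(** By monotonicity the worst case is when all vertices but v are revealed.  Then
either v is still free, and distributed as under the binomial law, or it is
forced to be absent, at the cost ln (1 / (1 - p)). *)
Lemma deficit_le v A : deficit mu p v A <= Prob (fun=> p) D * (p / (1 - p)).
Proof.
have /andP[p0 p1] := hp.
apply: le_trans (deficit_mono mu0 v hp (subsetT A)) _.
rewrite -mass_law_on /mass mulr_suml; apply: ler_sum => S _.
have [->|mS] := mu_cases mu0 S; first by rewrite !mul0r.
rewrite ler_pM2l //.
have aT : atom mu (v |: setT) S = mu S.
  rewrite /atom /mass (bigD1 S) //= big1 ?addr0 // => S' /andP[/eqP + /eqP].
  by rewrite setUT !setIT.
set a := atom mu (setT :\ v) S.
have aS : mu S <= a.
  by rewrite /a /atom /mass (bigD1 S) //= lerDl sumr_ge0 // => S' _; exact: mu0.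
have a0 : 0 < a by apply: lt_le_trans aS.
set x := (X in ln X).
have x0 : 0 < x.
  by rewrite /x aT !divr_gt0 //; case: ifP; rewrite ?subr_gt0.
apply: le_trans (ln_le_sub1 x0) _.
have -> : p / (1 - p) = (1 - p)^-1 - 1 by field; rewrite gt_eqF ?subr_gt0.
rewrite lerD2r /x aT; case: ifP => vS; last first.
  by rewrite ler_piMl ?invr_ge0 ?subr_ge0 ?(ltW p1) // ler_pdivrMr ?mul1r.
have DS : D S by rewrite -law_on_gt0.
have DSv : D (S :\ v) by apply: D_down DS; exact: subsetDl.
have e1 : mu (S :\ v) * p = mu S * (1 - p).
  rewrite /law_on DS DSv !(binom_law_except _ v) vS !inE eqxx /=.
  have -> : law_except (fun=> p) v S = law_except (fun=> p) v (S :\ v).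
    by rewrite -{1}(setD1K vS) law_exceptU.
  by ring.
have a2 : mu S <= p * a.
  have : mu S + mu (S :\ v) <= a.
    rewrite /a /atom /mass (bigD1 S) //= lerD2l (bigD1 (S :\ v)) /=.
      by rewrite lerDl sumr_ge0 // => S' _; exact: mu0.
    apply/andP; split.
      by apply/eqP/setP => i; rewrite !inE; case: eqVneq; rewrite ?andbF.
    by apply/eqP => /setP/(_ v); rewrite !inE eqxx vS.
  by rewrite -(ler_pM2l p0); lra.
rewrite ler_pdivrMr // ler_pdivrMr //.
apply: (le_trans a2); rewrite ler_pM2r //.
by rewrite ler_peMl ?(ltW p0) // invf_ge1 ?subr_gt0 //; lra.
Qed.

(** The law of the trace on A depends only on the density on A. *)
Lemma Prob_trace_eq (q q' : 'I_n -> R) A B : (forall i, i \in A -> q i = q' i) ->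
  Prob q (fun S => S :&: A == B :&: A) = Prob q' (fun S => S :&: A == B :&: A).
Proof.
move=> qq'.
have E r : Prob r (fun S => S :&: A == B :&: A) = \prod_i
    (r i * ((i \in A) ==> (i \in B))%:R + (1 - r i) * ((i \in A) ==> (i \notin B))%:R) :> R.
  rewrite -(Expect_prod r (fun i b => ((i \in A) ==> (b == (i \in B)))%:R)) -Expect_pred.
  apply: eq_Expect => S; have [e|ne] := eqVneq.
    rewrite big1 // => i _; move/setP/(_ i): e; rewrite !inE.
    by case: (i \in A) => //=; rewrite !andbT => ->; rewrite eqxx.
  have [i] : exists i, (i \in A) && ((i \in S) != (i \in B)).
    apply/existsP; apply: contraR ne; rewrite negb_exists => /forallP h.
    apply/eqP/setP => i; rewrite !inE; have := h i.
    by case: (i \in A); rewrite ?andbF ?andbT //= negbK => /eqP.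
  by case/andP => iA; rewrite (bigD1 i) //= iA /= => /negbTE ->; rewrite mul0r.
rewrite !E; apply: eq_bigr => i _.
by have [/qq' ->//|iA] := boolP (i \in A); rewrite /= !mulr1 addrCA subrr addrCA subrr.
Qed.

(** Gibbs' inequality against the probability law sg that draws the trace on A from
the binomial law and then each vertex v outside A independently with its
conditional probability.  The normalised conditioned law has density 1 / Z on D
with respect to the binomial one, so its relative entropy is - ln Z; comparing it
with sg leaves the sum of the relative entropies of the vertices outside A. *)
Lemma sum_cond_rel_ent_le A : 0 < Prob (fun=> p) D ->
  \sum_S mu S * (\sum_(v | v \notin A) rel_ent p (cprob mu A [set v] S))
  <= Prob (fun=> p) D * - ln (Prob (fun=> p) D).
Proof.
set Z := Prob _ D => Z0; have /andP[p0 p1] := hp.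
pose q S v := if v \in A then p else cprob mu A [set v] S.
have qE S S' : S' :&: A = S :&: A -> q S' = q S.
  by move=> e; apply: funext => v; rewrite /q /cprob (cexp_eq _ _ e).
(* The vector q S depends on S only through its trace on A, so sg is the law obtained
   by drawing that trace first. *)
pose sg S := binom_law (q S) S.
have sg1 : \sum_S sg S = 1.
  rewrite -(Expect_cst (fun _ : 'I_n => p) 1) /Expect.
  rewrite (partition_big (fun S => S :&: A) xpredT) //=.
  rewrite [RHS](partition_big (fun S => S :&: A) xpredT) //=.
  apply: eq_bigr => B _.
  have [<-|BA] := eqVneq (B :&: A) B; last first.
    rewrite !big1 // => S /eqP e; case/negP: BA; rewrite -e; apply/eqP.
      by rewrite -setIA setIid.
    by rewrite -setIA setIid.
  transitivity (Prob (q (B :&: A)) (fun S => S :&: A == B :&: A)).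
    apply: eq_bigr => S /eqP e; rewrite /sg (qE (B :&: A)) //.
    by rewrite e -setIA setIid.
  rewrite (@Prob_trace_eq _ (fun=> p)); last by move=> i iA; rewrite /q iA.
  by apply: eq_bigr => S _; rewrite mulr1.
have q_gt0 S i : 0 < mu S -> 0 < (if i \in S then q S i else 1 - q S i).
  move=> mS; rewrite /q; have [iA|iA] := boolP (i \in A).
    by case: ifP; rewrite ?subr_gt0.
  have pos (g : {set 'I_n} -> R) : (forall S, 0 <= g S) -> 0 < g S -> 0 < cexp mu A g S.
    move=> g0 gS; rewrite /cexp divr_gt0 ?(atom_gt0 mu0) // (bigD1 S) //=.
    by rewrite ltr_pwDl ?mulr_gt0 // sumr_ge0 // => S' _; rewrite mulr_ge0 ?mu0.
  case: ifP => iS.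
    by apply: pos => [S'|]; rewrite ?ler0n // sub1set iS ltr01.
  have -> : 1 - cprob mu A [set i] S = cexp mu A (fun S' => 1 - ([set i] \subset S')%:R) S.
    rewrite -[X in X - _ = _](cexp_cst mu0 A 1 mS) /cprob /cexp -mulrBl -sumrB; congr (_ / _).
    by apply: eq_bigr => S' _; rewrite mulrBr.
  apply: pos => [S'|]; first by rewrite subr_ge0 lern1 leq_b1.
  by rewrite sub1set iS subr0 ltr01.
have sg_ge0 S : 0 <= sg S.
  apply: binom_law_ge0 => i; rewrite /q; case: ifP => _.
    by rewrite !ltW.
  by rewrite (cprob_le1 mu0) (cprob_ge0 mu0).
pose be (b : bool) (x : R) := if b then x else 1 - x.
have be_gt0 b : 0 < be b p by rewrite /be; case: b; rewrite ?subr_gt0.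
have -> : \sum_S mu S * (\sum_(v | v \notin A) rel_ent p (cprob mu A [set v] S))
    = \sum_S mu S * ln (sg S / binom_law (fun=> p) S).
  transitivity (\sum_v \sum_S mu S * ln (be (v \in S) (q S v) / be (v \in S) p)).
    under eq_bigr => S _ do rewrite mulr_sumr.
    rewrite exchange_big /= big_mkcond; apply: eq_bigr => v _.
    case: ifP => [/negbTE vA|/negbFE vA]; last first.
      by rewrite big1 // => S _; rewrite /q vA divff ?gt_eqF // ln1 mulr0.
    pose l1 S := ln (q S v / p); pose l0 S := ln ((1 - q S v) / (1 - p)).
    have l1E S S' : S' :&: A = S :&: A -> l1 S' = l1 S by move=> e; rewrite /l1 (qE S).
    have l0E S S' : S' :&: A = S :&: A -> l0 S' = l0 S by move=> e; rewrite /l0 (qE S).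
    have t1 := cexp_tower mu0 (fun S => ([set v] \subset S)%:R) l1E.
    have t0 := cexp_tower mu0 (fun S => ([set v] \subset S)%:R) l0E.
    transitivity (\sum_S mu S * (cprob mu A [set v] S * l1 S)
        - \sum_S mu S * (cprob mu A [set v] S * l0 S)
        + \sum_S mu S * l0 S).
      rewrite -sumrB -big_split; apply: eq_bigr => S _ /=.
      by rewrite /rel_ent /l1 /l0 /q vA; ring.
    rewrite t1 t0 -sumrB -big_split; apply: eq_bigr => S _ /=.
    by rewrite sub1set /l1 /l0 /be; case: (v \in S); rewrite /= ?mul1r ?mul0r; ring.
  rewrite exchange_big /=; apply: eq_bigr => S _; rewrite -mulr_sumr.
  have [->|mS] := mu_cases mu0 S; first by rewrite !mul0r.
  congr (_ * _); rewrite /sg /binom_law -prodf_div.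
  have pos i : 0 < be (i \in S) (q S i) / be (i \in S) p.
    by rewrite divr_gt0 //; exact: q_gt0.
  rewrite -[RHS]/(ln (\prod_i (be (i \in S) (q S i) / be (i \in S) p))).
  suff [_ //] : 0 < \prod_i (be (i \in S) (q S i) / be (i \in S) p) /\
      \sum_i ln (be (i \in S) (q S i) / be (i \in S) p)
      = ln (\prod_i (be (i \in S) (q S i) / be (i \in S) p)).
  elim/big_rec2: _ => [|i y x _ [x0 ->]]; first by rewrite ln1.
  split; first exact: mulr_gt0.
  by rewrite [RHS]lnM ?posrE.
have step S : mu S * ln (sg S / binom_law (fun=> p) S)
    <= (if D S then Z * sg S else 0) - mu S * (1 + ln Z).
  rewrite {1 2}/law_on; case: (boolP (D S)) => DS; last by rewrite !mul0r subr0.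
  have mS : 0 < mu S by rewrite law_on_gt0.
  have sg0 : 0 < sg S by apply: prodr_gt0 => i _; exact: q_gt0.
  have pi0 : 0 < binom_law (fun=> p) S by exact: binom_law_gt0.
  have := ln_le_sub1 (mulr_gt0 (divr_gt0 sg0 pi0) Z0).
  rewrite [ln (_ * Z)]lnM ?posrE ?divr_gt0 // => h.
  have := ler_wpM2l (ltW pi0) h.
  have -> : binom_law (fun=> p) S * (sg S / binom_law (fun=> p) S * Z - 1)
    = Z * sg S - binom_law (fun=> p) S by field; rewrite gt_eqF.
  by lra.
apply: le_trans (ler_sum _ (fun S _ => step S)) _.
rewrite sumrB -mulr_suml -/(mass mu xpredT) mass_law_on -/Z.
suff : \sum_S (if D S then Z * sg S else 0) <= Z by lra.
rewrite -[leRHS]mulr1 -sg1 mulr_sumr; apply: ler_sum => S _.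
by case: ifP => // _; rewrite mulr_ge0 ?(ltW Z0).
Qed.

End DownSet.

(** * Influences of monotone set functions *)

Section Influence.
Variables (R : realType) (n : nat).
Implicit Types (A S T : {set 'I_n}) (f : {set 'I_n} -> R) (a : R).

Lemma deriv_prod (I : eqType) (r : seq I) (G : I -> {poly R}) : uniq r ->
  (\prod_(i <- r) G i)^`()
  = \sum_(j <- r) (G j)^`() * \prod_(i <- r | i != j) G i.
Proof.
elim: r => [|j r IH] /=; first by rewrite !big_nil derivC.
case/andP => jr /IH {}IH; rewrite !big_cons derivM IH eqxx /=.
congr (_ * _ + _).
  rewrite [RHS]big_seq_cond [LHS]big_seq_cond; apply: eq_bigl => i.
  by case: eqVneq => [->|]; rewrite ?(negbTE jr) ?andbT.
rewrite mulr_sumr [LHS]big_seq [RHS]big_seq; apply: eq_bigr => i ir.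
by rewrite big_cons; case: eqVneq => [e|_]; [rewrite e ir in jr | rewrite mulrCA].
Qed.

(** The mean of f under density a, as a polynomial in a. *)
Definition Expect_poly f : {poly R} :=
  \sum_A (f A)%:P * \prod_(i < n) (if i \in A then 'X else 1 - 'X).

Lemma horner_Expect_poly f a : (Expect_poly f).[a] = Expect (fun=> a) f.
Proof.
rewrite /Expect_poly horner_sum; apply: eq_bigr => A _.
rewrite hornerM hornerC mulrC horner_prod; congr (_ * _).
by apply: eq_bigr => i _; case: ifP; rewrite !hornerE.
Qed.

Definition influence a u f :=
  Expect (fun=> a) (fun A => f (u |: A)) - Expect (fun=> a) (fun A => f (A :\ u)).

Lemma influenceE a u f : influence a u f =
  \sum_(A : {set 'I_n} | u \notin A) law_except (fun=> a) u A * (f (u |: A) - f A).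
Proof.
rewrite /influence !(Expect_split _ u) -sumrB; apply: eq_bigr => A uA.
rewrite setUA setUid setU1K // (_ : A :\ u = A); first by ring.
by apply/setP => i; rewrite !inE; case: eqVneq => // ->; rewrite (negbTE uA).
Qed.

(** Russo's formula.  It is derived for polynomials, where the derivative of the
product over vertices is formal. *)
Lemma russo f a : (Expect_poly f)^`().[a] = \sum_u influence a u f.
Proof.
rewrite /Expect_poly raddf_sum horner_sum.
transitivity (\sum_A \sum_u f A * ((if u \in A then 1 else -1) * law_except (fun=> a) u A)).
  apply: eq_bigr => A _; rewrite /= derivM derivC mul0r add0r hornerM hornerC.
  rewrite deriv_prod ?index_enum_uniq // horner_sum mulr_sumr.
  apply: eq_bigr => u _; rewrite hornerM horner_prod; congr (_ * (_ * _)).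
    case: ifP => _; first by rewrite derivX -polyC1 hornerC.
    by rewrite derivB derivX -polyC1 derivC sub0r hornerN hornerC.
  by apply: eq_bigr => i _; case: ifP; rewrite !hornerE.
rewrite exchange_big /=; apply: eq_bigr => u _.
rewrite influenceE (sum_set_split u); apply: eq_bigr => A uA.
by rewrite setU11 (negbTE uA) law_exceptU; ring.
Qed.

Lemma influence_sum a u (I : Type) (r : seq I) (F : I -> {set 'I_n} -> R) :
  influence a u (fun A => \sum_(i <- r) F i A) = \sum_(i <- r) influence a u (F i).
Proof. by rewrite /influence !Expect_sum -sumrB. Qed.

Lemma influence_ge0 a u f : 0 <= a <= 1 -> (forall A B : {set _}, A \subset B -> f A <= f B) ->
  0 <= influence a u f.
Proof.
move=> ha fm; rewrite subr_ge0; apply: le_Expect => // S; apply: fm.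
by apply: subset_trans (subsetDl _ _) (subsetUr _ _).
Qed.

(** The mean of f varies by at most M between the densities d and 2 d; the mean
value theorem and [russo] conclude. *)
Lemma exists_low_influence f (M d : R) : 0 < d -> 2 * d <= 1 ->
  (forall A, 0 <= f A <= M) ->
  exists a, d < a < 2 * d /\ \sum_u influence a u f <= M / d.
Proof.
move=> d0 d1 fM.
have dd : d < 2 * d by lra.
have [|c] := @MVT R (horner (Expect_poly f)) (horner (Expect_poly f)^`()) _ _ dd
  (fun x _ => is_derive_poly _ x).
  by apply: continuous_subspaceT => x; exact: continuous_horner.
rewrite in_itv /= => hc; rewrite !horner_Expect_poly russo => e; exists c; split => //.
have -> : \sum_u influence c u f = (Expect (fun=> 2 * d) f - Expect (fun=> d) f) / d.
  by rewrite e; field; rewrite gt_eqF.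
rewrite ler_pM2r ?invr_gt0 // lerBlDr -[leLHS]addr0 lerD //.
  rewrite -[leRHS](Expect_cst (fun _ : 'I_n => 2 * d)); apply: le_Expect => [i|S].
    lra.
  by case/andP: (fM S).
apply: Expect_ge0 => [i|S]; first lra.
by case/andP: (fM S).
Qed.

(** The vertices of T are revealed successively.  The increment at a vertex, after
others have been added to A, is a nonnegative function evaluated at an enlarged
set, so [Expect_absorb] compares it with the increment at A itself at the price
of one factor 1 / a per added vertex. *)
Lemma influence_union f a T : 0 < a <= 1 -> (forall A B : {set _}, A \subset B -> f A <= f B) ->
  Expect (fun=> a) (fun A => f (A :|: T) - f A)
  <= (a^-1) ^+ #|T| * \sum_(u in T) influence a u f.
Proof.
move=> ha fm; have /andP[a0 a1] := ha.
have va : prob_vec (fun _ : 'I_n => a) by move=> _; rewrite a1 ltW.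
have i0 u : 0 <= influence a u f by rewrite influence_ge0 // a1 ltW.
have ai : 1 <= a^-1 by rewrite invf_ge1.
elim/set_card_ind: T => [|v T vT IH].
  rewrite big_set0 mulr0 -[leRHS](Expect_cst (fun _ : 'I_n => a)).
  by apply: le_Expect => // S; rewrite setU0 subrr.
rewrite big_setU1 //= cardsU1 vT mulrDr.
have -> : Expect (fun=> a) (fun A => f (A :|: (v |: T)) - f A)
   = Expect (fun=> a) (fun A => f (v |: A) - f A)
   + Expect (fun=> a) (fun A => f ((v |: A) :|: T) - f (v |: A)).
  rewrite -ExpectD; apply: eq_Expect => A.
  by rewrite [v |: A]setUC -setUA; ring.
apply: lerD.
  apply: (@le_trans _ _ (influence a v f)).
    rewrite ExpectB lerD2l lerN2; apply: le_Expect => // S.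
    by apply: fm; exact: subsetDl.
  by rewrite ler_peMl // exprn_ege1.
apply: le_trans (Expect_absorb v (f := fun A => f (A :|: T) - f A) ha _) _.
  by move=> S; rewrite subr_ge0 fm // subsetUl.
by rewrite exprS -mulrA ler_pM2l ?invr_gt0.
Qed.

End Influence.

(** * Edges of hypergraphs with bounded codegree *)

Section Hypergraph.
Variables (R : realType) (n k K : nat) (E : {set {set 'I_n}}).
Implicit Types (S A T e : {set 'I_n}).

Definition edges_in S := #|[set e in E | e \subset S]|.

Lemma edges_inE S : (edges_in S)%:R = \sum_(e in E) (e \subset S)%:R :> R.
Proof.
rewrite /edges_in -sum1_card natr_sum big_mkcond [RHS]big_mkcond /=.
by apply: eq_bigr => e _; rewrite inE; case: (e \in E); case: (e \subset S).
Qed.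

Lemma edges_in_mono S T : S \subset T -> (edges_in S <= edges_in T)%N.
Proof.
move=> ST; apply: subset_leq_card; apply/subsetP => e; rewrite !inE.
by case/andP => -> /subset_trans ->.
Qed.

Lemma Expect_edges (q : 'I_n -> R) :
  Expect q (fun S => (edges_in S)%:R) = \sum_(e in E) \prod_(i in e) q i.
Proof.
under eq_Expect do rewrite edges_inE.
by rewrite Expect_sum; apply: eq_bigr => e _; rewrite Expect_edge.
Qed.

Hypothesis unif : forall e, e \in E -> #|e| = k.

Lemma sum_prod_cst (p : R) :
  \sum_(e in E) \prod_(i in e) p = #|E|%:R * p ^+ k.
Proof.
rewrite (eq_bigr (fun=> p ^+ k)) => [|e eE]; first by rewrite sumr_const mulr_natl.
by rewrite prodr_const unif.
Qed.

Hypothesis codeg : forall u v, u != v ->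
  (#|[set e in E | (u \in e) && (v \in e)]| <= K)%N.

(** Each ordered pair of distinct vertices is counted once for each of the at most
K edges that contain it. *)
Lemma sum_pairs_le (d : 'I_n -> 'I_n -> R) : (forall u v, 0 <= d u v) ->
  \sum_(e in E) \sum_(v in e) \sum_(u in e :\ v) d u v
  <= K%:R * \sum_u \sum_v d u v.
Proof.
move=> d0.
have -> : \sum_(e in E) \sum_(v in e) \sum_(u in e :\ v) d u v
   = \sum_u \sum_v \sum_(e in E) (if (u \in e) && (v \in e) && (u != v) then d u v else 0).
  under [in RHS]eq_bigr => u _ do rewrite exchange_big /=.
  rewrite [RHS]exchange_big /=.
  under [RHS]eq_bigr => e _ do rewrite exchange_big /=.
  apply: eq_bigr => e _; rewrite big_mkcond; apply: eq_bigr => v _.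
  case: ifP => ve; last by rewrite big1 // => u _; rewrite andbF.
  rewrite big_mkcond; apply: eq_bigr => u _; rewrite !inE.
  by rewrite andbT andbC.
rewrite mulr_sumr; apply: ler_sum => u _; rewrite mulr_sumr; apply: ler_sum => v _.
have [uv|uv] := eqVneq u v.
  by rewrite big1 ?mulr_ge0 ?ler0n // => e _; rewrite andbF.
rewrite -big_mkcondr /= (eq_bigl (mem [set e in E | (u \in e) && (v \in e)])); last first.
  by move=> e; rewrite !inE andbT.
by rewrite sumr_const -[leLHS]mulr_natl ler_wpM2r // ler_nat codeg.
Qed.

Lemma Expect_exists (q : 'I_n -> R) (G : {set 'I_n} -> R) B : prob_vec q ->
  Expect q G <= B -> exists A, G A <= B.
Proof.
move=> vq h; case: (@arg_minP _ _ _ set0 xpredT G isT) => A _ minA.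
exists A; apply: le_trans h; rewrite -[leLHS](Expect_cst q).
by apply: le_Expect => // S; exact: minA.
Qed.

Section Conditioned.
Variables (p : R) (D : pred {set 'I_n}).
Hypothesis hp : 0 < p < 1.
Hypothesis D_down : forall S T, S \subset T -> D T -> D S.
Local Notation mu := (law_on p D).
Local Notation Z := (Prob (fun=> p) D).

(** The information needed by [prod_cprob_le], summed over all edges, has the order
of n p Z instead of that of the number of edges: it is a sum of increments of the
deficits, and these are controlled by the total influence. *)
Lemma Expect_sum_cmi_le (d : R) : 0 < d -> 2 * d <= 1 ->
  exists a, d < a < 2 * d /\
   Expect (fun=> a) (fun A => \sum_(e in E | [disjoint e & A]) \sum_(v in e)
      \sum_S mu S * cmi mu A (e :\ v) [set v] S)
   <= d^-1 ^+ k.-1 * (K%:R * (n%:R * (Z * (p / (1 - p))) / d)).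
Proof.
move=> d0 d1; pose f v A := deficit mu p v A.
have mu0 := law_on_ge0 D hp.
have fm v (A B : {set 'I_n}) : A \subset B -> f v A <= f v B by exact: deficit_mono.
have [A|a [ha ia]] := @exists_low_influence R n (fun A => \sum_v f v A)
   (n%:R * (Z * (p / (1 - p)))) d d0 d1.
  rewrite sumr_ge0 /= => [|v _]; last exact: deficit_ge0.
  apply: le_trans (ler_sum _ (fun v _ => deficit_le hp D_down v A)) _.
  by rewrite sumr_const card_ord mulr_natl.
exists a; split => //; have /andP[da a2] := ha.
have a0 : 0 < a by lra.
have a1 : a <= 1 by lra.
have va : prob_vec (fun _ : 'I_n => a) by move=> _; rewrite a1 ltW.
have i0 u v : 0 <= influence a u (f v) by rewrite influence_ge0 ?a1 ?(ltW a0) //; exact: fm.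
apply: (@le_trans _ _ (Expect (fun=> a)
   (fun A => \sum_(e in E) \sum_(v in e) (f v (A :|: (e :\ v)) - f v A)))).
  apply: le_Expect => // A; rewrite big_mkcondr /=; apply: ler_sum => e eE.
  case: ifP => dA; last by apply: sumr_ge0 => v _; rewrite subr_ge0 fm ?subsetUl.
  apply: ler_sum => v ve; rewrite (@sum_cmi _ _ mu mu0 p) ?inE ?eqxx //.
  by move: dA; rewrite disjoints_subset => /subsetP/(_ v ve); rewrite inE.
rewrite Expect_sum.
apply: (@le_trans _ _ (\sum_(e in E) \sum_(v in e) d^-1 ^+ k.-1 *
   \sum_(u in e :\ v) influence a u (f v))).
  apply: ler_sum => e eE; rewrite Expect_sum; apply: ler_sum => v ve.
  apply: le_trans (influence_union _ _ (fm v)) _; first by rewrite a0.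
  rewrite ler_wpM2r ?sumr_ge0 //.
  have -> : #|e :\ v| = k.-1 by rewrite -(unif eE) (cardsD1 v e) ve.
  by rewrite lerXn2r ?nnegrE ?invr_ge0 ?(ltW a0) ?(ltW d0) // lef_pV2 ?posrE // ltW.
under eq_bigr => e _ do rewrite -mulr_sumr.
rewrite -mulr_sumr ler_wpM2l ?exprn_ge0 ?invr_ge0 ?(ltW d0) //.
apply: le_trans (sum_pairs_le i0) _.
rewrite ler_wpM2l ?ler0n //.
by under eq_bigr => u _ do rewrite -influence_sum.
Qed.

End Conditioned.
End Hypergraph.

(** * Decoupling the edges of a conditioned random set *)

Section LowerBound.
Variables (R : realType) (n k K : nat) (E : {set {set 'I_n}}).
Implicit Types (S A T e : {set 'I_n}).
Hypothesis unif : forall e, e \in E -> #|e| = k.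
Hypothesis codeg : forall u v, u != v ->
  (#|[set e in E | (u \in e) && (v \in e)]| <= K)%N.
Variables (p : R) (D : pred {set 'I_n}) (t : R).
Hypothesis hp : 0 < p < 1.
Hypothesis D_down : forall S T, S \subset T -> D T -> D S.
Hypothesis ht : 0 < t <= 2^-1.
Local Notation mu := (law_on p D).
Local Notation Z := (Prob (fun=> p) D).

(** For edges disjoint from A this is the error term of [prod_cprob_le]; for the
others, the trivial bound. *)
Definition decoupling_err A S : R := \sum_(e in E)
  (if [disjoint e & A] then
     \sum_(v in e) cmi mu A (e :\ v) [set v] S / t + 2 * t * k%:R * p ^+ k
   else p ^+ k).

Definition cond_density A S (v : 'I_n) := if v \in A then p else cprob mu A [set v] S.

Lemma cond_density_bounds A S v : 0 < mu S -> 0 <= cond_density A S v <= p.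
Proof.
move=> mS; have /andP[p0 p1] := hp; rewrite /cond_density; case: ifP => vA.
  by rewrite lexx ltW.
by rewrite (cprob_ge0 (law_on_ge0 D hp)) /= (cprob1_le hp D_down) ?vA.
Qed.

(** Edges disjoint from A are handled by [prod_cprob_le]; for the others the error
alone is already at least the product. *)
Lemma mean_cond_density_le A S : 0 < mu S ->
  \sum_(e in E) \prod_(v in e) cond_density A S v
  <= cexp mu A (fun S' => (edges_in E S')%:R) S + decoupling_err A S.
Proof.
move=> mS; have mu0 := law_on_ge0 D hp; have /andP[p0 p1] := hp.
have -> : cexp mu A (fun S' => (edges_in E S')%:R) S = \sum_(e in E) cprob mu A e S.
  rewrite /cprob -cexp_sum /cexp; congr (_ / _); apply: eq_bigr => S' _.
  by rewrite (edges_inE R).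
rewrite /decoupling_err -big_split /=; apply: ler_sum => e eE; case: ifP => dA.
  have := prod_cprob_le hp D_down dA mS ht; rewrite (unif eE) -addrA.
  apply: le_trans; rewrite le_eqVlt; apply/orP; left; apply/eqP.
  apply: eq_bigr => v ve; rewrite /cond_density ifF //; apply/negbTE.
  by move: dA; rewrite disjoints_subset => /subsetP/(_ v ve); rewrite inE.
rewrite -[leLHS]add0r lerD ?(cprob_ge0 mu0) //.
rewrite -(unif eE) -prodr_const; apply: ler_prod => v _; exact: cond_density_bounds.
Qed.

(** Averaging over a random A: the information is bounded by [Expect_sum_cmi_le] and
an edge meets A with probability at most k times the density. *)
Lemma exists_low_decoupling_err (d : R) : 0 < d -> 2 * d <= 1 -> exists A,
  \sum_S mu S * decoupling_err A S <= Z *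
    (t^-1 * (d^-1 ^+ k.-1 * (K%:R * (n%:R * (p / (1 - p))) / d))
     + #|E|%:R * p ^+ k * (2 * t * k%:R + 2 * d * k%:R)).
Proof.
move=> d0 d1; have mu0 := law_on_ge0 D hp; have /andP[p0 p1] := hp.
have /andP[t0 t2] := ht.
have pk0 : 0 <= p ^+ k by rewrite exprn_ge0 // ltW.
have Z0 : 0 <= Z by rewrite -mass_law_on; apply: mass_ge0.
have [a [/andP[da a2] ha]] := Expect_sum_cmi_le unif codeg hp D_down d0 d1.
have a0 : 0 < a by lra.
have va : prob_vec (fun _ : 'I_n => a) by move=> _; rewrite (ltW a0) /=; lra.
apply: (Expect_exists va).
pose X A : R := \sum_(e in E | [disjoint e & A]) \sum_(v in e)
      \sum_S mu S * cmi mu A (e :\ v) [set v] S.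
apply: (@le_trans _ _ (Expect (fun=> a) (fun A => t^-1 * X A
   + Z * (#|E|%:R * p ^+ k * (2 * t * k%:R))
   + Z * p ^+ k * \sum_(e in E) \sum_(v in e) ([set v] \subset A)%:R))).
  apply: le_Expect => // A; rewrite /decoupling_err.
  under eq_bigr => S _ do rewrite mulr_sumr.
  rewrite exchange_big /= /X big_mkcondr /= mulr_sumr.
  have -> : Z * (#|E|%:R * p ^+ k * (2 * t * k%:R)) = \sum_(e in E) Z * (2 * t * k%:R * p ^+ k).
    by rewrite sumr_const -mulr_natl; ring.
  rewrite mulr_sumr -!big_split /=; apply: ler_sum => e eE.
  have s0 : 0 <= Z * p ^+ k * \sum_(v in e) ([set v] \subset A)%:R.
    by rewrite mulr_ge0 ?mulr_ge0 // sumr_ge0 // => v _; exact: ler0n.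
  case: ifP => dA.
    rewrite -[leLHS]addr0 lerD // le_eqVlt; apply/orP; left; apply/eqP.
    under eq_bigr => S _ do rewrite mulrDr.
    rewrite big_split /= -mulr_suml -/(mass mu xpredT) mass_law_on; congr (_ + _).
    rewrite mulr_sumr; under eq_bigr => S _ do rewrite mulr_sumr.
    rewrite exchange_big /=; apply: eq_bigr => v _; rewrite mulr_sumr.
    by apply: eq_bigr => S _; rewrite mulrCA mulrC; ring.
  rewrite mulr0 add0r -mulr_suml -/(mass mu xpredT) mass_law_on.
  rewrite -[leLHS]add0r lerD //.
    by rewrite !mulr_ge0 ?ler0n ?(ltW t0).
  have /pred0Pn[v /= /andP[ve vA]] := negbT dA.
  rewrite ler_peMr ?mulr_ge0 // (bigD1 v) //= sub1set vA lerDl sumr_ge0 //.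
rewrite !ExpectD !ExpectZ Expect_cst Expect_sum.
have -> : \sum_(e in E) Expect (fun=> a) (fun A => \sum_(v in e) ([set v] \subset A)%:R)
    = #|E|%:R * (k%:R * a).
  rewrite -sumr_const mulr_suml; apply: eq_bigr => e eE; rewrite mul1r Expect_sum.
  rewrite -(unif eE) -sumr_const mulr_suml; apply: eq_bigr => v _.
  by rewrite Expect_edge big_set1 mul1r.
have h1 : t^-1 * Expect (fun=> a) X
    <= Z * (t^-1 * (d^-1 ^+ k.-1 * (K%:R * (n%:R * (p / (1 - p))) / d))).
  rewrite mulrCA ler_pM2l ?invr_gt0 //; apply: le_trans ha _.
  by rewrite le_eqVlt; apply/orP; left; apply/eqP; ring.
have h2 : Z * p ^+ k * (#|E|%:R * (k%:R * a)) <= Z * p ^+ k * (#|E|%:R * (k%:R * (2 * d))).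
  by rewrite !ler_wpM2l ?mulr_ge0 // ltW.
lra.
Qed.

End LowerBound.

(** * A cheap density with few edges *)

(** The set A is provided by [exists_low_decoupling_err].  Averaged over the
conditioned law, the cost of the conditional density is at most the target and
its error is at most eps^2 m; hence some sample S has cost at most the target
divided by 1 - eps and error at most eps m at the same time. *)
Lemma exists_cheap_density (R : realType) (k K : nat) (p0 eps c : R) :
  (0 < k)%N -> p0 < 1 -> 0 < eps < 1 -> 0 < c ->
  exists L : R, 0 < L /\ forall (n : nat) (E : {set {set 'I_n}}) (p eta : R),
    (forall e, e \in E -> #|e| = k) ->
    (forall u v, u != v -> (#|[set e in E | (u \in e) && (v \in e)]| <= K)%N) ->
    (0 < n)%N -> c * n%:R ^+ 2 <= #|E|%:R -> 0 < p < 1 -> p <= p0 ->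
    L <= n%:R * p ^+ k.-1 -> 0 <= eta <= 1 ->
    exists q : 'I_n -> R, prob_vec q /\
      \sum_(e in E) \prod_(i in e) q i <= (eta + eps) * (#|E|%:R * p ^+ k) /\
      (1 - eps) * \sum_i rel_ent p (q i)
      <= - ln (Prob (fun=> p) (fun S => (edges_in E S)%:R <= eta * (#|E|%:R * p ^+ k))).
Proof.
move=> k0 p01 /andP[e0 e1] c0.
have kR : 1 <= k%:R :> R by rewrite ler1n.
(* The same t sets the scale of the density of A and enters the information bound;
   with this value each of the two terms linear in t contributes th / 4. *)
pose th := eps ^+ 2; pose t := th / (8 * k%:R).
have th0 : 0 < th by rewrite exprn_gt0.
have th1 : th < 1 by rewrite /th expr2 mulr_ilt1 // ltW.
have t0 : 0 < t by rewrite divr_gt0 // mulr_gt0 //; lra.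
have tk : t * k%:R = th / 8 by rewrite /t; field; rewrite gt_eqF //; lra.
have t8 : 8 * t <= 1.
  have : t <= t * k%:R by rewrite ler_peMr // ltW.
  lra.
pose C := t^-1 * (t^-1 ^+ k.-1 * K%:R / t).
have C0 : 0 <= C by rewrite !mulr_ge0 ?exprn_ge0 ?invr_ge0 ?ler0n ?(ltW t0).
have q0 : 0 < 1 - p0 by rewrite subr_gt0.
pose L := 2 * C / (th * c * (1 - p0)) + 1.
have L0 : 0 < L.
  have h0 : 0 < th * c * (1 - p0) by rewrite !mulr_gt0.
  have : 0 <= 2 * C / (th * c * (1 - p0)) by rewrite divr_ge0 ?(ltW h0) // mulr_ge0.
  by rewrite /L; lra.
exists L; split => // n E p eta unif codeg n0 cE hp pp0 Lnp /andP[eta0 eta1].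
have /andP[pp p1] := hp.
set m := #|E|%:R * p ^+ k.
set D := fun S : {set 'I_n} => (edges_in E S)%:R <= eta * m.
have nR : 0 < n%:R :> R by rewrite ltr0n.
have E0 : 0 < #|E|%:R :> R by apply: lt_le_trans cE; rewrite mulr_gt0 ?exprn_gt0.
have m0 : 0 < m by rewrite mulr_gt0 ?exprn_gt0.
have D_down (S T : {set 'I_n}) : S \subset T -> D T -> D S.
  by move=> ST; apply: le_trans; rewrite ler_nat edges_in_mono.
set Z := Prob (fun=> p) D.
have vp : prob_vec (fun _ : 'I_n => p) by move=> _; rewrite !ltW.
have D0 : D set0.
  rewrite /D.
  suff -> : edges_in E set0 = 0%N by rewrite mulr_ge0 ?(ltW m0).
  apply/eqP; rewrite /edges_in cards_eq0; apply/eqP/setP => e; rewrite !inE subset0.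
  apply/negP => /andP[/unif + /eqP e_0]; rewrite e_0 cards0 => k_0.
  by rewrite -k_0 in k0.
have Z0 : 0 < Z.
  rewrite /Z /Prob (bigD1 set0) //= ltr_pwDl ?binom_law_gt0 // sumr_ge0 // => S _.
  exact: binom_law_ge0.
(* The full set is not in D, hence Z < 1 and the target La is positive; this makes
   the averaging argument below strict. *)
have DT : ~~ D setT.
  rewrite /D -ltNge (_ : edges_in E setT = #|E|); last first.
    by apply: eq_card => e; rewrite inE subsetT andbT.
  have pk : p ^+ k < 1 by rewrite exprn_ilt1 ?(ltW pp) // -lt0n.
  have : m < #|E|%:R by rewrite /m gtr_pMr.
  have : eta * m <= m by rewrite ler_piMl ?(ltW m0).
  lra.
have Z1 : Z < 1.
  rewrite -(Expect_cst (fun _ : 'I_n => p) 1) /Expect (bigID D) /= /Z /Prob.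
  under [X in _ < X + _]eq_bigr do rewrite mulr1.
  rewrite ltrDl (bigD1 setT) //= ltr_pwDl ?mulr1 ?binom_law_gt0 // sumr_ge0 // => S _.
  by rewrite mulr1 binom_law_ge0.
pose La := - ln Z.
have La0 : 0 < La by rewrite oppr_gt0 ln_lt0 ?Z0.
have ht : 0 < t <= 2^-1 by rewrite t0 /=; lra.
have [|A hA] := exists_low_decoupling_err unif codeg hp D_down ht t0; first lra.
pose mu := law_on p D; have mu0 := law_on_ge0 D hp : forall S, 0 <= mu S.
pose G S := \sum_i rel_ent p (cond_density p D A S i).
have G0 S : 0 < mu S -> 0 <= G S.
  move=> mS; apply: sumr_ge0 => i _; apply: rel_ent_ge0 => //.
  by have /andP[-> /=] := cond_density_bounds hp D_down A i mS; lra.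
have hG : \sum_S mu S * G S <= Z * La.
  apply: le_trans (sum_cond_rel_ent_le hp A Z0).
  rewrite le_eqVlt; apply/orP; left; apply/eqP; apply: eq_bigr => S _.
  congr (_ * _); rewrite /G [RHS]big_mkcond; apply: eq_bigr => i _.
  by rewrite /cond_density; case: (i \in A) => //=; rewrite rel_ent_refl.
have hErr : \sum_S mu S * decoupling_err k E p D t A S <= Z * (th * m).
  apply: le_trans hA _; rewrite ler_pM2l //.
  have -> : 2 * t * k%:R + 2 * t * k%:R = th / 2 by have := tk; lra.
  have hC : C / (1 - p0) <= L * th * c / 2.
    have -> : L * th * c / 2 = C / (1 - p0) + th * c / 2.
      by rewrite /L; field; rewrite !gt_eqF ?mulr_gt0.
    by rewrite lerDl divr_ge0 ?mulr_ge0 // ltW.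
  have -> : t^-1 * (t^-1 ^+ k.-1 * (K%:R * (n%:R * (p / (1 - p))) / t))
      = C * (n%:R * (p / (1 - p))) by rewrite /C; ring.
  have h1 : C * (n%:R * (p / (1 - p))) <= C / (1 - p0) * (n%:R * p).
    have -> : C / (1 - p0) * (n%:R * p) = C * (n%:R * (p / (1 - p0))) by ring.
    rewrite ler_wpM2l // ler_pM2l // ler_pM2l // lef_pV2 ?posrE ?subr_gt0 //; lra.
  have h2 : C / (1 - p0) * (n%:R * p) <= L * th * c / 2 * (n%:R * p).
    by rewrite ler_pM2r // mulr_gt0.
  have h3 : L * th * c / 2 * (n%:R * p) <= (n%:R * p ^+ k.-1) * (th * c / 2 * (n%:R * p)).
    have -> : L * th * c / 2 * (n%:R * p) = L * (th * c / 2 * (n%:R * p)) by ring.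
    by rewrite ler_pM2r // !mulr_gt0 // ?invr_gt0.
  have h4 : (n%:R * p ^+ k.-1) * (th * c / 2 * (n%:R * p)) = th / 2 * (c * n%:R ^+ 2 * p ^+ k).
    by have -> : p ^+ k = p * p ^+ k.-1 by [rewrite -exprS prednK]; ring.
  have h5 : th / 2 * (c * n%:R ^+ 2 * p ^+ k) <= th / 2 * m.
    by rewrite ler_pM2l ?divr_gt0 // ler_pM2r ?exprn_gt0.
  rewrite -/m; lra.
have [S [mS gS eS]] : exists S, [/\ 0 < mu S, (1 - eps) * G S <= La &
    decoupling_err k E p D t A S <= eps * m].
  apply: contrapT => no.
  (* Otherwise a combination of cost and error exceeds its own mean: the weights are
   such that either failure alone is enough. *)
  have big S : 0 < mu S -> mu S * (La * (eps * m))
      < mu S * ((1 - eps) * G S * (eps * m) + decoupling_err k E p D t A S * La).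
    move=> mS; rewrite ltr_pM2l //.
    have G1 : 0 <= (1 - eps) * G S by rewrite mulr_ge0 ?G0 //; lra.
    have Er0 : 0 <= decoupling_err k E p D t A S.
      apply: sumr_ge0 => e _; case: ifP => _; last by rewrite exprn_ge0 // ltW.
      apply: addr_ge0; last by rewrite mulr_ge0 ?exprn_ge0 ?(ltW pp) // mulr_ge0 // mulr_ge0 // ltW.
      by apply: sumr_ge0 => v _; rewrite divr_ge0 ?(ltW t0) ?(cmi_ge0 mu0).
    have em : 0 < eps * m by rewrite mulr_gt0.
    have EL0 := mulr_ge0 Er0 (ltW La0).
    have GE0 := mulr_ge0 G1 (ltW em).
    have [gS|gS] := leP ((1 - eps) * G S) La; last first.
      have : La * (eps * m) < (1 - eps) * G S * (eps * m) by rewrite ltr_pM2r.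
      lra.
    have eS : eps * m < decoupling_err k E p D t A S.
      by rewrite ltNge; apply/negP => eS; apply: no; exists S.
    have : (eps * m) * La < decoupling_err k E p D t A S * La by rewrite ltr_pM2r.
    lra.
  have ms : \sum_S mu S = Z by exact: (mass_law_on p D).
  have lt0 : \sum_S mu S * (La * (eps * m)) <
      \sum_S mu S * ((1 - eps) * G S * (eps * m) + decoupling_err k E p D t A S * La).
    rewrite (bigD1 set0) //= [ltRHS](bigD1 set0) //= ltr_leD ?big ?law_on_gt0 //.
    apply: ler_sum => S _; have [->|mS] := mu_cases mu0 S; first by rewrite !mul0r.
    exact/ltW/big.
  move: lt0; apply/negP; rewrite -leNgt.
  rewrite -mulr_suml ms.
  have -> : \sum_S mu S * ((1 - eps) * G S * (eps * m) + decoupling_err k E p D t A S * La)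
     = (1 - eps) * (eps * m) * (\sum_S mu S * G S)
       + La * \sum_S mu S * decoupling_err k E p D t A S.
    by rewrite !mulr_sumr -big_split; apply: eq_bigr => S _ /=; ring.
  have h1 : (1 - eps) * (eps * m) * (\sum_S mu S * G S) <= (1 - eps) * (eps * m) * (Z * La).
    have e10 : 0 < 1 - eps by lra.
    by rewrite ler_pM2l // mulr_gt0 // mulr_gt0.
  have h2 : La * \sum_S mu S * decoupling_err k E p D t A S <= La * (Z * (th * m))
    by rewrite ler_pM2l.
  have h3 : (1 - eps) * (eps * m) * (Z * La) + La * (Z * (th * m)) = Z * (La * (eps * m)).
    by rewrite /th; ring.
  lra.
exists (cond_density p D A S); split.
  by move=> i; have /andP[-> /=] := cond_density_bounds hp D_down A i mS; lra.
split => //.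
apply: le_trans (mean_cond_density_le unif hp D_down ht A mS) _.
rewrite mulrDl lerD // -[leRHS](cexp_cst mu0 A _ mS).
apply: cexp_le => // S' _ mS'.
by move: mS'; rewrite /mu law_on_gt0.
Qed.

(** * Change of measure *)

Section Tilting.
Variables (R : realType) (n : nat).
Implicit Types (S : {set 'I_n}).

(** For an absent vertex the logarithm is at most p / (1 - p).  For a present one,
with u = - ln (q / p), the bound u^2 / 2 <= e^u = p / q removes the singularity
at q = 0. *)
Lemma llr_second_moment (p q : R) : 0 < p < 1 -> 0 <= q <= p ->
  q * ln (q / p) ^+ 2 + (1 - q) * ln ((1 - q) / (1 - p)) ^+ 2
  <= (2 + ((1 - p)^-1) ^+ 2) * p.
Proof.
move=> /andP[p0 p1] /andP[q0 qp]; rewrite [leRHS]mulrDl; apply: lerD.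
  have [->|q_neq0] := eqVneq q 0; first by rewrite mul0r mulr_ge0 // ltW.
  have qpos : 0 < q by rewrite lt_def q_neq0.
  have x0 : 0 < q / p by rewrite divr_gt0.
  have u0 : 0 <= - ln (q / p).
    by rewrite oppr_ge0 ln_le0 // ler_pdivrMr ?mul1r.
  have := expR_ge1Dxn 1 u0; rewrite expRN lnK ?posrE // sqrrN invf_div.
  have -> : (2`!)%:R = 2 :> R by [].
  move=> h; have := ler_wpM2l (ltW qpos) h.
  have -> : q * (p / q) = p by field.
  rewrite mulrDr mulr1; lra.
have r0 : 0 < (1 - q) / (1 - p) by rewrite divr_gt0; lra.
have r1 : 1 <= (1 - q) / (1 - p) by rewrite ler_pdivlMr ?mul1r; lra.
have l0 := ln_ge0 r1.
have l1 : ln ((1 - q) / (1 - p)) <= p / (1 - p).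
  apply: le_trans (ln_le_sub1 r0) _.
  have -> : (1 - q) / (1 - p) - 1 = (p - q) / (1 - p) by field; lra.
  by rewrite ler_pM2r ?invr_gt0; lra.
have l2 : ln ((1 - q) / (1 - p)) ^+ 2 <= (p / (1 - p)) ^+ 2.
  by rewrite lerXn2r // nnegrE; lra.
apply: (@le_trans _ _ (ln ((1 - q) / (1 - p)) ^+ 2)).
  by rewrite ler_piMl ?exprn_ge0 //; lra.
apply: (le_trans l2); rewrite exprMn mulrC ler_wpM2l ?exprn_ge0 ?invr_ge0 //; first lra.
by rewrite expr2 ler_piMl //; lra.
Qed.

(** The centred summands depend on distinct independent vertices, hence are
orthogonal. *)
Lemma variance_le (q : 'I_n -> R) (l : 'I_n -> bool -> R) : prob_vec q ->
  Expect q (fun S => (\sum_i l i (i \in S)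
     - \sum_i (q i * l i true + (1 - q i) * l i false)) ^+ 2)
  <= \sum_i (q i * l i true ^+ 2 + (1 - q i) * l i false ^+ 2).
Proof.
move=> vq; pose kap i := q i * l i true + (1 - q i) * l i false.
pose g i S := l i (i \in S) - kap i.
have -> : Expect q (fun S => (\sum_i l i (i \in S) - \sum_i kap i) ^+ 2)
    = \sum_i \sum_j Expect q (fun S => g i S * g j S).
  under [RHS]eq_bigr do rewrite -Expect_sum.
  rewrite -Expect_sum; apply: eq_Expect => S.
  by rewrite -sumrB expr2 big_distrlr.
apply: ler_sum => i _; rewrite (bigD1 i) //= [X in _ + X]big1 ?addr0 => [|j ji].
  rewrite (Expect_coord _ i) /g.
  under eq_Expect do rewrite setU11; under [X in _ + _ * X]eq_Expect do rewrite !inE eqxx /=.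
  rewrite !Expect_cst.
  have -> : q i * ((l i true - kap i) * (l i true - kap i))
     + (1 - q i) * ((l i false - kap i) * (l i false - kap i))
     = q i * l i true ^+ 2 + (1 - q i) * l i false ^+ 2 - kap i ^+ 2.
    by rewrite /kap; ring.
  by rewrite gerBl sqr_ge0.
rewrite (Expect_coord _ i) /g.
under eq_Expect do rewrite setU11 !inE (negbTE ji) /=.
under [X in _ + _ * X]eq_Expect do rewrite !inE eqxx ji /=.
by rewrite !ExpectZ /kap; ring.
Qed.

Definition llr (p : R) (q : 'I_n -> R) i (b : bool) :=
  ln ((if b then q i else 1 - q i) / (if b then p else 1 - p)).

Lemma binom_law_tilt p q S : 0 < p < 1 -> prob_vec q ->
  binom_law q S * expR (- \sum_i llr p q i (i \in S)) <= binom_law (fun=> p) S.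
Proof.
move=> /andP[p0 p1] vq; rewrite -sumrN expR_sum -big_split /=.
apply: ler_prod => i _; have /andP[q0 q1] := vq i; rewrite /llr.
have : 0 < (if i \in S then p else 1 - p) by case: ifP; lra.
have : 0 <= (if i \in S then q i else 1 - q i) by case: ifP; lra.
move: (if _ then q i else _) (if _ then p else _) => x y x0 y0.
rewrite mulr_ge0 ?expR_ge0 //=.
have [->|x_neq0] := eqVneq x 0; first by rewrite mul0r ltW.
have xp : 0 < x by rewrite lt_def x_neq0.
rewrite expRN lnK ?posrE ?divr_gt0 // invf_div le_eqVlt; apply/orP; left; apply/eqP.
by field.
Qed.

(** Where the log-likelihood ratio is at most its mean plus a, the density of
[n]_p with respect to [n]_q is at least exp(- mean - a); Chebyshev's inequality
bounds the exceptional probability. *)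
Lemma Prob_tilt_ge p (q : 'I_n -> R) (D : pred {set 'I_n}) (a : R) :
  0 < p < 1 -> (forall i, 0 <= q i <= p) -> 0 < a ->
  expR (- (\sum_i rel_ent p (q i) + a))
   * (Prob q D - n%:R * ((2 + ((1 - p)^-1) ^+ 2) * p) / a ^+ 2)
  <= Prob (fun=> p) D.
Proof.
move=> hp hq a0; have /andP[p0 p1] := hp.
have vq : prob_vec q by move=> i; have := hq i; lra.
pose U S := \sum_i llr p q i (i \in S); pose Kl := \sum_i rel_ent p (q i).
rewrite -!(Expect_pred _ D).
have var : Expect q (fun S => (U S - Kl) ^+ 2) <= n%:R * ((2 + ((1 - p)^-1) ^+ 2) * p).
  apply: le_trans (variance_le (llr p q) vq) _.
  apply: (@le_trans _ _ (\sum_(i < n) (2 + ((1 - p)^-1) ^+ 2) * p)).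
    by apply: ler_sum => i _; exact: llr_second_moment.
  by rewrite sumr_const card_ord mulr_natl.
have step : Expect q (fun S => (D S)%:R - (U S - Kl) ^+ 2 / a ^+ 2)
    <= Expect q (fun S => (D S && (U S <= Kl + a))%:R).
  apply: le_Expect => // S; case: (boolP (D S)) => DS /=; last first.
    by rewrite sub0r oppr_le0 divr_ge0 ?sqr_ge0 // exprn_ge0 // ltW.
  have [h|h] := leP (U S) (Kl + a).
    by rewrite gerBl divr_ge0 ?sqr_ge0 // exprn_ge0 // ltW.
  rewrite subr_le0 ler_pdivlMr ?exprn_gt0 // mul1r lerXn2r ?nnegrE; lra.
apply: (@le_trans _ _ (expR (- (Kl + a)) * Expect q (fun S => (D S && (U S <= Kl + a))%:R))).
  rewrite ler_pM2l ?expR_gt0 //; apply: le_trans step.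
  rewrite ExpectB lerD2l lerN2.
  under eq_Expect do rewrite mulrC.
  by rewrite ExpectZ mulrC ler_pM2r ?invr_gt0 ?exprn_gt0.
rewrite -ExpectZ; apply: ler_sum => S _.
case: (boolP (D S)) => DS /=; last by rewrite !mulr0.
rewrite mulr1; apply: le_trans (binom_law_tilt S hp vq).
rewrite ler_wpM2l ?binom_law_ge0 //.
have [h|h] := leP (U S) (Kl + a); last by rewrite mulr0 expR_ge0.
by rewrite mulr1 ler_expR lerN2.
Qed.

(** A union bound, multiplied by p to avoid the exponent |T| - 1. *)
Lemma prod_ge_sum (p : R) (q : 'I_n -> R) (T : {set 'I_n}) :
  (forall i, 0 <= q i <= p) ->
  p ^+ #|T| * (p - \sum_(i in T) (p - q i)) <= p * \prod_(i in T) q i.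
Proof.
move=> hq; elim/set_card_ind: T => [|v T vT IH].
  by rewrite !big_set0 cards0 mul1r subr0 mulr1.
rewrite !big_setU1 //= cardsU1 vT exprS mulrCA.
have /andP[q0 qp] := hq v.
apply: le_trans (ler_wpM2l q0 IH).
rewrite mulrCA [p * _]mulrC -mulrA ler_wpM2l ?exprn_ge0 //; first lra.
have s0 : 0 <= \sum_(i in T) (p - q i).
  by apply: sumr_ge0 => i _; have := hq i; lra.
have := ler_wpM2r s0 qp; lra.
Qed.

End Tilting.

(** * The cost of a density with few edges *)

Section Degrees.
Variables (R : realType) (n k K : nat) (E : {set {set 'I_n}}).
Hypothesis unif : forall e, e \in E -> #|e| = k.
Hypothesis codeg : forall u v, u != v ->
  (#|[set e in E | (u \in e) && (v \in e)]| <= K)%N.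
Hypothesis k2 : (2 <= k)%N.

(** A vertex lies in at most K n edges: as k >= 2, each such edge contains another
vertex. *)
Lemma sum_deg_le (d : 'I_n -> R) : (forall v, 0 <= d v) ->
  \sum_(e in E) \sum_(v in e) d v <= K%:R * (n%:R * \sum_v d v).
Proof.
move=> d0.
have -> : n%:R * \sum_v d v = \sum_(u < n) \sum_v d v.
  by rewrite sumr_const card_ord mulr_natl.
apply: le_trans (sum_pairs_le codeg (d := fun _ v => d v) _) => //.
apply: ler_sum => e eE; apply: ler_sum => v ve.
rewrite sumr_const -[leRHS]mulr_natl ler_peMl // ler1n.
by move: k2; rewrite -(unif eE) (cardsD1 v e) ve add1n ltnS.
Qed.

(** Lowering the mean number of edges by a proportion b requires lowering the
density by a total of order b |E| p / n, as all degrees are O(n). *)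
Lemma sum_decrease_ge (p b : R) (q : 'I_n -> R) : 0 < p -> (forall i, 0 <= q i <= p) ->
  \sum_(e in E) \prod_(i in e) q i <= (1 - b) * (#|E|%:R * p ^+ k) ->
  b * #|E|%:R * p <= K%:R * (n%:R * \sum_i (p - q i)).
Proof.
move=> p0 hq hE.
apply: le_trans (sum_deg_le _); last by move=> v; have := hq v; lra.
have pk : 0 < p ^+ k by rewrite exprn_gt0.
rewrite -(ler_pM2l pk).
have : \sum_(e in E) p ^+ k * (p - \sum_(i in e) (p - q i))
    <= p * \sum_(e in E) \prod_(i in e) q i.
  rewrite mulr_sumr; apply: ler_sum => e eE.
  by rewrite -(unif eE); exact: prod_ge_sum.
rewrite -mulr_sumr sumrB sumr_const -[p *+ _]mulr_natl.
have := ler_wpM2l (ltW p0) hE; lra.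
Qed.

(** Markov's inequality; when x = 0 the number of edges vanishes almost surely. *)
Lemma Prob_edges_markov (q : 'I_n -> R) (b x : R) : prob_vec q -> 0 <= x -> b <= 1 ->
  \sum_(e in E) \prod_(i in e) q i <= (1 - b) * x ->
  b <= Prob q (fun S => (edges_in E S)%:R <= x).
Proof.
move=> vq x0 b1; rewrite -(Expect_edges) => h.
rewrite -Expect_pred.
suff : Expect q (fun S => 1 - ((edges_in E S)%:R <= x :> R)%:R) <= 1 - b.
  by rewrite ExpectB Expect_cst; lra.
move: x0; rewrite le_eqVlt => /orP[/eqP x_0|xp].
  rewrite -x_0 mulr0 in h.
  apply: (@le_trans _ _ 0); last lra.
  apply: le_trans h; apply: le_Expect => // S; rewrite -x_0 lern0.
  by case: (edges_in E S) => [|m] /=; rewrite ?subrr ?subr0 ?ler1n.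
rewrite -(ler_pM2r xp); apply: le_trans h; rewrite mulrC -ExpectZ.
apply: le_Expect => // S; have [_|/ltW] := leP ((edges_in E S)%:R : R) x.
  by rewrite /= subrr mulr0 ler0n.
by rewrite /= subr0 mulr1.
Qed.

End Degrees.

(** The loss a in [Prob_tilt_ge] and the logarithm of the factor eps / 2 are each at
most (eps / 2) c1 n p, while the cost of any feasible q is at least c1 n p. *)
Lemma lower_tail_cost_le (R : realType) (k K : nat) (p0 eps c : R) :
  (2 <= k)%N -> p0 < 1 -> 0 < eps < 1 -> 0 < c ->
  exists L : R, 0 < L /\ forall (n : nat) (E : {set {set 'I_n}}) (p eta : R),
    (forall e, e \in E -> #|e| = k) ->
    (forall u v, u != v -> (#|[set e in E | (u \in e) && (v \in e)]| <= K)%N) ->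
    (0 < n)%N -> c * n%:R ^+ 2 <= #|E|%:R -> 0 < p < 1 -> p <= p0 ->
    L <= n%:R * p ^+ k.-1 -> 0 <= eta <= 1 ->
    forall q : 'I_n -> R, prob_vec q ->
      \sum_(e in E) \prod_(i in e) q i <= (1 - eps) * eta * (#|E|%:R * p ^+ k) ->
      - ln (Prob (fun=> p) (fun S => (edges_in E S)%:R <= eta * (#|E|%:R * p ^+ k)))
      <= (1 + eps) * \sum_i rel_ent p (q i).
Proof.
move=> k2 p01 /andP[e0 e1] c0.
pose b := eps * c / (K%:R + 1).
have K1 : 0 < K%:R + 1 :> R by rewrite ltr_wpDl.
have b0 : 0 < b by rewrite divr_gt0 // mulr_gt0.
pose c1 := b ^+ 2 / 8; have c10 : 0 < c1 by rewrite divr_gt0 ?exprn_gt0.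
pose C2 := 2 + ((1 - p0)^-1) ^+ 2.
have C20 : 0 < C2 by rewrite ltr_pwDl // exprn_ge0 // invr_ge0; lra.
have ln0 : 0 < - ln (eps / 2).
  by rewrite oppr_gt0 ln_lt0 // divr_gt0 //=; lra.
pose La := 8 * C2 / (eps ^+ 3 * c1 ^+ 2); pose Lb := 2 * (- ln (eps / 2)) / (eps * c1).
have La0 : 0 < La by rewrite divr_gt0 ?mulr_gt0 ?exprn_gt0.
have Lb0 : 0 < Lb by rewrite divr_gt0 ?mulr_gt0.
exists (La + Lb); split; first by rewrite addr_gt0.
move=> n E p eta unif codeg n0 cE hp pp0 Lnp /andP[eta0 eta1] q0 vq0 hq0.
have /andP[pp p1] := hp.
have nR : 0 < n%:R :> R by rewrite ltr0n.
set m := #|E|%:R * p ^+ k.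
have m0 : 0 <= m by rewrite mulr_ge0 ?exprn_ge0 // ltW.
(* Truncation at p increases neither the mean number of edges nor the relative entropy. *)
pose q i := Num.min (q0 i) p.
have hq i : 0 <= q i <= p.
  by rewrite /q le_min ge_min lexx orbT andbT (ltW pp) andbT; case/andP: (vq0 i).
have vq : prob_vec q by move=> i; have := hq i; lra.
have hqE : \sum_(e in E) \prod_(i in e) q i <= (1 - eps) * (eta * m).
  rewrite mulrA; apply: le_trans hq0; apply: ler_sum => e _; apply: ler_prod => i _.
  by have /andP[-> _] := hq i; rewrite /q ge_min lexx.
have hK : \sum_i rel_ent p (q i) <= \sum_i rel_ent p (q0 i).
  apply: ler_sum => i _; rewrite /q; case: (leP (q0 i) p) => // _.
  by rewrite rel_ent_refl // rel_ent_ge0.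
apply: (@le_trans _ _ ((1 + eps) * \sum_i rel_ent p (q i))); last first.
  by rewrite ler_pM2l //; lra.
pose Kl := \sum_i rel_ent p (q i); rewrite -/Kl.
pose np := n%:R * p; have np0 : 0 < np by rewrite mulr_gt0.
have hnp : La + Lb <= np.
  apply: (le_trans Lnp); rewrite ler_pM2l //.
  have -> : k.-1 = (k.-2).+1 by move: k2; clear; case: k => [|[]].
  by rewrite exprS ler_piMr ?(ltW pp) // exprn_ile1 // ltW.
pose s := \sum_i (p - q i).
have s_ge : b * np <= s.
  have h : (1 - eps) * (eta * m) <= (1 - eps) * m.
    by rewrite ler_wpM2l ?ler_piMl //; lra.
  have := sum_decrease_ge unif codeg k2 pp hq (le_trans hqE h).
  rewrite -/s => h1.
  have h2 : eps * (c * n%:R ^+ 2) * p <= eps * #|E|%:R * p.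
    by rewrite ler_pM2r // ler_pM2l.
  have s0 : 0 <= s by apply: sumr_ge0 => i _; have := hq i; lra.
  have h3 : K%:R * (n%:R * s) <= (K%:R + 1) * (n%:R * s).
    by rewrite ler_wpM2r ?mulr_ge0 ?(ltW nR) // lerDl.
  rewrite -(ler_pM2l nR) -(ler_pM2l K1).
  have -> : (K%:R + 1) * (n%:R * (b * np)) = eps * (c * n%:R ^+ 2) * p.
    by rewrite /b /np; field; rewrite gt_eqF.
  exact: le_trans h2 (le_trans h1 h3).
have s_le : s <= np.
  rewrite /s /np mulr_natl -[X in _ *+ X](card_ord n) -sumr_const; apply: ler_sum => i _.
  by have := hq i; lra.
have b1 : b <= 1 by rewrite -(ler_pM2r np0) mul1r; apply: le_trans s_ge s_le.
have KlE : c1 * np <= Kl.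
  have : \sum_i (b / 4 * (p - q i) - 2 * (b / 4) ^+ 2 * p) <= Kl.
    apply: ler_sum => i _.
    (* The choice t = b / 4 maximises t b - 2 t^2. *)
    have hb : 0 <= b / 4 <= 2^-1 by lra.
    apply: le_trans (rel_ent_lb hp (vq i) hb).
    rewrite lerD2l lerN2 ler_wpM2l //; last by have := hq i; lra.
    by rewrite mulr_ge0 // exprn_ge0 //; lra.
  rewrite sumrB -mulr_sumr -/s.
  have : b / 4 * (b * np) <= b / 4 * s by rewrite ler_pM2l // divr_gt0.
  have -> : \sum_(i < n) 2 * (b / 4) ^+ 2 * p = c1 * np.
    by rewrite sumr_const card_ord -[LHS]mulr_natr /c1 /np; field.
  have -> : b / 4 * (b * np) = 2 * (c1 * np) by rewrite /c1; field.
  lra.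
pose a := eps / 2 * (c1 * np).
have a0 : 0 < a by rewrite mulr_gt0 ?divr_gt0 ?mulr_gt0.
pose D : pred {set 'I_n} := fun S => (edges_in E S)%:R <= eta * m.
have := Prob_tilt_ge D hp hq a0; rewrite -/Kl.
have PD : eps <= Prob q D.
  by apply: Prob_edges_markov => //; [exact: mulr_ge0 | exact: ltW].
have Vle : n%:R * ((2 + ((1 - p)^-1) ^+ 2) * p) / a ^+ 2 <= eps / 2.
  rewrite ler_pdivrMr ?exprn_gt0 //.
  have h1 : n%:R * ((2 + ((1 - p)^-1) ^+ 2) * p) <= C2 * np.
    have -> : C2 * np = n%:R * (C2 * p) by rewrite /np; ring.
    rewrite ler_pM2l // ler_pM2r // lerD2l lerXn2r ?nnegrE ?invr_ge0; try lra.
    by rewrite lef_pV2 ?posrE; lra.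
  apply: (le_trans h1).
  have -> : eps / 2 * a ^+ 2 = (eps ^+ 3 * c1 ^+ 2 / 8 * np) * np by rewrite /a; field.
  rewrite ler_pM2r //.
  have -> : C2 = eps ^+ 3 * c1 ^+ 2 / 8 * La.
    by rewrite /La; field; rewrite !gt_eqF.
  by rewrite ler_pM2l ?divr_gt0 ?mulr_gt0 ?exprn_gt0 //; lra.
move=> h.
have {}h : expR (- (Kl + a)) * (eps / 2) <= Prob (fun=> p) D.
  by apply: le_trans h; rewrite ler_pM2l ?expR_gt0 //; lra.
have P0 : 0 < Prob (fun=> p) D.
  by apply: lt_le_trans h; rewrite mulr_gt0 ?expR_gt0 // divr_gt0.
have e20 : 0 < eps / 2 by lra.
have : ln (expR (- (Kl + a)) * (eps / 2)) <= ln (Prob (fun=> p) D).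
  by rewrite ler_ln // posrE mulr_gt0 ?expR_gt0.
rewrite lnM ?posrE ?expR_gt0 // expRK => hl.
have lna : - ln (eps / 2) <= a.
  have -> : - ln (eps / 2) = eps / 2 * c1 * Lb.
    by rewrite /Lb; field; rewrite !gt_eqF.
  have -> : a = eps / 2 * c1 * np by rewrite /a mulrA.
  by rewrite ler_pM2l ?mulr_gt0 //; lra.
have aK : a <= eps / 2 * Kl by rewrite ler_pM2l.
rewrite -/(Prob (fun=> p) D); lra.
Qed.

(** * Arithmetic progressions as a hypergraph *)

Section Progressions.
Variables (k n : nat).
Hypothesis k2 : (2 <= k)%N.

Definition AP_sets : {set {set 'I_n}} := [set B | `[< is_AP k B >]].

Definition ap (x d : nat) : {set 'I_n} :=
  [set i | (val i).+1 \in [seq (x + j * d)%N | j <- iota 0 k]].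

Lemma nAP_edges S : nAP k S = edges_in AP_sets S.
Proof. by apply: eq_card => B; rewrite !inE andbC. Qed.

Lemma mem_shift (B : {set 'I_n}) (i : 'I_n) :
  ((val i).+1 \in [seq (val j).+1 | j <- enum B]) = (i \in B).
Proof.
rewrite -mem_enum; apply: (mem_map (f := fun j : 'I_n => (val j).+1)).
by move=> a b [] /val_inj.
Qed.

Lemma AP_setsE B : B \in AP_sets -> exists x d, (0 < d)%N /\ B = ap x d.
Proof.
rewrite inE => /asboolP[x [d [d0 h]]]; exists x, d; split => //.
by apply/setP => i; rewrite inE -h mem_shift.
Qed.

Lemma uniq_ap_seq (x d : nat) : (0 < d)%N -> uniq [seq (x + j * d)%N | j <- iota 0 k].
Proof.
move=> d0; rewrite map_inj_uniq ?iota_uniq // => a b /eqP.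
by rewrite eqn_add2l eqn_pmul2r // => /eqP.
Qed.

Lemma card_AP B : B \in AP_sets -> #|B| = k.
Proof.
rewrite inE => /asboolP[x [d [d0 h]]].
rewrite cardE -(size_map (fun i : 'I_n => (val i).+1)).
rewrite (perm_size (uniq_perm _ (uniq_ap_seq x d0) h)); first by rewrite size_map size_iota.
by rewrite map_inj_uniq ?enum_uniq // => a b [] /val_inj.
Qed.

Lemma codeg_AP_lt (u v : 'I_n) : (u < v)%N ->
  (#|[set e in AP_sets | (u \in e) && (v \in e)]| <= k ^ 2)%N.
Proof.
move=> uv.
(* The progression in which u and v have ranks z.1 and z.2. *)
pose g (z : 'I_k * 'I_k) := let d := ((v - u) %/ (z.2 - z.1))%N in ap (u.+1 - z.1 * d) d.
apply: (@leq_trans #|[set g z | z : 'I_k * 'I_k]|); last first.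
  by rewrite -[(k ^ 2)%N](_ : #|{: 'I_k * 'I_k}| = _) ?leq_imset_card // card_prod card_ord mulnn.
apply: subset_leq_card; apply/subsetP => B; rewrite inE => /and3P[/AP_setsE[x [d [d0 ->]]]].
rewrite !inE => /mapP[i + ei] /mapP[j + ej]; rewrite !mem_iota !add0n /= => ik jk.
apply/imsetP; exists (Ordinal ik, Ordinal jk) => //; rewrite /g /=.
have ij : (i < j)%N by rewrite -(ltn_pmul2r d0) -(ltn_add2l x) -ei -ej ltnS.
have -> : (v - u = (j - i) * d)%N.
  by rewrite -subSS ei ej subnDl -mulnBl.
by rewrite mulKn ?subn_gt0 // ei addnK.
Qed.

(** Two distinct elements and their ranks in the progression determine it. *)
Lemma codeg_AP (u v : 'I_n) : u != v ->
  (#|[set e in AP_sets | (u \in e) && (v \in e)]| <= k ^ 2)%N.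
Proof.
move=> uv; have [lt|gt|e] := ltngtP u v; first exact: codeg_AP_lt.
  apply: leq_trans (codeg_AP_lt gt); apply: subset_leq_card; apply/subsetP => e.
  by rewrite !inE => /and3P[-> -> ->].
by case/eqP: uv; apply: val_inj.
Qed.

Lemma ap_in_sets (x d : nat) : (0 < x)%N -> (0 < d)%N -> (x + k.-1 * d <= n)%N ->
  ap x d \in AP_sets.
Proof.
move=> x0 d0 xn; rewrite inE; apply/asboolP; exists x, d; split => // y.
apply/idP/idP => [/mapP[i]|].
  by rewrite mem_enum inE => h ->.
case/mapP => j; rewrite mem_iota add0n => /= jk ->.
have jn : ((x + j * d).-1 < n)%N.
  rewrite prednK ?addn_gt0 ?x0 //; apply: leq_trans xn.
  by rewrite leq_add2l leq_mul2r -ltnS prednK ?jk ?orbT // ltnW.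
have e : ((x + j * d).-1.+1 = x + j * d)%N by rewrite prednK ?addn_gt0 ?x0.
rewrite -e; apply/mapP; exists (Ordinal jn) => //.
rewrite mem_enum inE /= e; apply/mapP; exists j => //.
by rewrite mem_iota.
Qed.

Lemma ap_sub (x d x' d' : nat) : (0 < x)%N -> (0 < d)%N ->
  (x + k.-1 * d <= n)%N -> ap x d \subset ap x' d' ->
  forall j, (j < k)%N -> exists2 j', (j' < k)%N & (x + j * d = x' + j' * d')%N.
Proof.
move=> x0 d0 xn sub j jk.
have jn : ((x + j * d).-1 < n)%N.
  rewrite prednK ?addn_gt0 ?x0 //; apply: leq_trans xn.
  by rewrite leq_add2l leq_mul2r -ltnS prednK ?jk ?orbT // ltnW.
have e : ((x + j * d).-1.+1 = x + j * d)%N by rewrite prednK ?addn_gt0 ?x0.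
have : Ordinal jn \in ap x d.
  by rewrite inE /= e; apply/mapP; exists j => //; rewrite mem_iota.
by move/(subsetP sub); rewrite inE /= e => /mapP[j']; rewrite mem_iota add0n => h ->; exists j'.
Qed.

(** The first elements are the minima; the second element of each progression
exceeds the minimum by a multiple of the difference of the other one, so the two
differences are equal. *)
Lemma ap_inj (x d x' d' : nat) : (0 < x)%N -> (0 < d)%N -> (x + k.-1 * d <= n)%N ->
  (0 < x')%N -> (0 < d')%N -> (x' + k.-1 * d' <= n)%N ->
  ap x d = ap x' d' -> x = x' /\ d = d'.
Proof.
move=> x0 d0 xn x0' d0' xn' e.
have s1 : ap x d \subset ap x' d' by rewrite e.
have s2 : ap x' d' \subset ap x d by rewrite e.
have k0 : (0 < k)%N by exact: ltnW.
have [j1 _ h1] := ap_sub x0 d0 xn s1 k0.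
have [j2 _ h2] := ap_sub x0' d0' xn' s2 k0.
have xx : x = x'.
  apply/eqP; rewrite eqn_leq; move: h1 h2; rewrite !mul0n !addn0 => h1 h2.
  by rewrite {1}h2 leq_addr /= h1 leq_addr.
split => //; subst x'.
have [j3 _ h3] := ap_sub x0 d0 xn s1 k2.
have [j4 _ h4] := ap_sub x0' d0' xn' s2 k2.
move: h3 h4 => /eqP; rewrite eqn_add2l mul1n => /eqP h3 /eqP.
rewrite eqn_add2l mul1n => /eqP h4.
have p3 : (0 < j3)%N by move: d0; rewrite h3 muln_gt0 => /andP[].
have p4 : (0 < j4)%N by move: d0'; rewrite h4 muln_gt0 => /andP[].
apply/eqP; rewrite eqn_leq; apply/andP; split.
  by rewrite h4 leq_pmull.
by rewrite h3 leq_pmull.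
Qed.

(** With m = n / k, all starting points and differences in {1, ..., m} give
progressions contained in [n]. *)
Lemma card_AP_sets_ge : ((n %/ k) ^ 2 <= #|AP_sets|)%N.
Proof.
set m := (n %/ k)%N.
have bound (a b : 'I_m) : (a.+1 + k.-1 * b.+1 <= n)%N.
  apply: (@leq_trans (k * m)); last by rewrite mulnC leq_divM.
  rewrite -[in leqRHS](prednK (ltnW k2)) mulSn leq_add //.
  by rewrite leq_mul2l ltn_ord orbT.
pose g (z : 'I_m * 'I_m) := ap z.1.+1 z.2.+1.
have gi : injective g.
  move=> [a b] [a' b'] /ap_inj; rewrite !ltn0Sn !bound => /(_ isT isT isT isT isT isT).
  by case=> [[/val_inj ->] [/val_inj ->]].
apply: (@leq_trans #|[set g z | z : 'I_m * 'I_m]|).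
  by rewrite card_imset // card_prod card_ord mulnn.
apply: subset_leq_card; apply/subsetP => B /imsetP[[a b] _ ->].
by apply: ap_in_sets => //; exact: bound.
Qed.

Lemma card_AP_sets_geR (R : realType) : (k <= n)%N ->
  (4 * k%:R ^+ 2)^-1 * n%:R ^+ 2 <= #|AP_sets|%:R :> R.
Proof.
move=> kn; have k0 : (0 < k)%N by exact: ltnW.
have kR : 0 < k%:R :> R by rewrite ltr0n.
rewrite ler_pdivrMl ?mulr_gt0 ?exprn_gt0 //.
apply: (@le_trans _ _ (((2 * k * (n %/ k)) ^ 2)%N%:R)).
  rewrite -natrX ler_nat leq_exp2r //.
  have m1 : (0 < n %/ k)%N by rewrite divn_gt0.
  apply: (@leq_trans ((n %/ k).+1 * k)); first exact/ltnW/ltn_ceil.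
  by rewrite mulnAC leq_mul2r mul2n -addnn -addn1 leq_add2l m1 orbT.
have -> : ((2 * k * (n %/ k)) ^ 2)%N%:R = 4 * k%:R ^+ 2 * ((n %/ k) ^ 2)%N%:R :> R.
  by rewrite !natrX !natrM; ring.
rewrite ler_pM2l ?mulr_gt0 ?exprn_gt0 //.
by rewrite ler_nat card_AP_sets_ge.
Qed.

End Progressions.

(** * The variational problem *)

Section Final.
Variables (R : realType).

Lemma mean_AP_edges (k n : nat) (q : 'I_n -> R) :
  mean_AP k q = \sum_(e in AP_sets k n) \prod_(i in e) q i.
Proof. by rewrite /mean_AP -Expect_edges; apply: eq_Expect => S; rewrite nAP_edges. Qed.

Lemma mean_AP_cst (k n : nat) (p : R) : (0 < k)%N ->
  mean_AP k (fun _ : 'I_n => p) = #|AP_sets k n|%:R * p ^+ k.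
Proof.
by move=> k0; rewrite mean_AP_edges (sum_prod_cst (k := k)) // => e; exact: card_AP.
Qed.

(** The hypothesis on p gives L^(k-1) <= n p^(k-1), and L <= L^(k-1) for L >= 1. *)
Lemma density_bound (k n : nat) (L p : R) : (2 <= k)%N -> (0 < n)%N -> 1 <= L ->
  L * n%:R `^ (- ((k.-1)%:R)^-1) <= p -> L <= n%:R * p ^+ k.-1.
Proof.
move=> k2 n0 L1 hp.
have k1 : (0 < k.-1)%N by rewrite -ltnS prednK // ltnW.
have nR : 0 < n%:R :> R by rewrite ltr0n.
have L0 : 0 < L by apply: lt_le_trans L1.
have h0 : 0 <= L * n%:R `^ (- ((k.-1)%:R)^-1) by rewrite mulr_ge0 ?powR_ge0 ?ltW.
have := lerXn2r k.-1 h0 (le_trans h0 hp) hp.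
have e : (n%:R `^ (- ((k.-1)%:R)^-1)) ^+ k.-1 = n%:R^-1 :> R.
  rewrite -powR_mulrn ?powR_ge0 // -powRrM mulNr mulVf; last by rewrite pnatr_eq0 -lt0n.
  by rewrite powRN powRr1 // ltW.
rewrite exprMn e => h.
have LL : L <= L ^+ k.-1 by rewrite -[k.-1]prednK // exprS ler_peMr ?exprn_ege1 // ltW.
by apply: le_trans LL _; rewrite mulrC -ler_pdivrMr.
Qed.

Lemma Phi_ge0 (k n : nat) (p eta : R) : 0 < p < 1 -> (0 <= Phi k n p eta)%E.
Proof.
move=> hp; apply: le_ereal_inf_tmp => _ [q [hq _] <-].
by rewrite lee_fin sumr_ge0 // => i _; exact: rel_ent_ge0.
Qed.

Lemma Phi_le (k n : nat) (p eta : R) (q : 'I_n -> R) : prob_vec q ->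
  mean_AP k q <= eta * mean_AP k (fun _ : 'I_n => p) ->
  (Phi k n p eta <= (\sum_(i < n) rel_ent p (q i))%:E)%E.
Proof. by move=> vq hq; apply: ereal_inf_lbound; exists q. Qed.

End Final.

Theorem theorem4 (R : realType) (k : nat) (p0 eps : R) :
  (2 <= k)%N -> p0 < 1 -> 0 < eps ->
  exists L : R, 0 < L /\
    forall (n : nat) (p : R),
      (0 < n)%N -> 0 < p < 1 ->
      L * n%:R `^ (- ((k.-1)%:R)^-1) <= p <= p0 ->
      forall eta : R, 0 <= eta <= 1 ->
        ((1 - eps)%:E * Phi k n p (eta + eps)
           <= (- ln (lower_tail k n p eta))%:E)%E /\
        ((- ln (lower_tail k n p eta))%:E
           <= (1 + eps)%:E * Phi k n p ((1 - eps) * eta))%E.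
Proof.
move=> k2 p01 eps0; have k0 : (0 < k)%N by exact: ltnW.
(* Large eps is reduced to eps <= 1/2: the bound for a smaller eps is stronger. *)
pose e1 := Num.min eps 2^-1.
have he1 : 0 < e1 < 1.
  by rewrite /e1 lt_min eps0 invr_gt0 ltr0n /= gt_min; apply/orP; right; lra.
have e1_le : e1 <= eps by rewrite /e1 ge_min lexx.
have c0 : 0 < (4 * k%:R ^+ 2)^-1 :> R by rewrite invr_gt0 mulr_gt0 ?exprn_gt0 ?ltr0n.
have [L1 [L10 low]] := exists_cheap_density (k ^ 2) k0 p01 he1 c0.
have [L2 [L20 upp]] := lower_tail_cost_le (k ^ 2) k2 p01 he1 c0.
have kR : 1 <= k%:R :> R by rewrite ler1n.
exists (L1 + L2 + k%:R); split; first by lra.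
move=> n p n0 hp /andP[hL pp0] eta heta; have /andP[pp p1] := hp.
have hden : L1 + L2 + k%:R <= n%:R * p ^+ k.-1.
  by apply: density_bound hL => //; lra.
have kn : (k <= n)%N.
  rewrite -(ler_nat R); apply: (@le_trans _ _ (n%:R * p ^+ k.-1)); first lra.
  by rewrite ler_piMr ?ler0n // exprn_ile1 // ltW.
have unif := @card_AP k n; have codeg := @codeg_AP k n.
have cE := card_AP_sets_geR k2 R kn.
have lt_eq : lower_tail k n p eta = Prob (fun=> p)
    (fun S => (edges_in (AP_sets k n) S)%:R <= eta * (#|AP_sets k n|%:R * p ^+ k)).
  rewrite /lower_tail mean_AP_cst //; apply: eq_bigl => S.
  by rewrite nAP_edges.
have m0 : 0 <= #|AP_sets k n|%:R * p ^+ k by rewrite mulr_ge0 ?exprn_ge0 // ltW.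
split.
  have [q [vq [hq lq]]] := low n (AP_sets k n) p eta (@unif) (@codeg) n0 cE hp pp0 ltac:(lra) heta.
  rewrite -lt_eq in lq.
  have S0 : 0 <= \sum_i rel_ent p (q i) by apply: sumr_ge0 => i _; exact: rel_ent_ge0.
  have l0 : 0 <= - ln (lower_tail k n p eta).
    by apply: le_trans lq; rewrite mulr_ge0 //; lra.
  (* For eps >= 1 the left-hand side is nonpositive, whether the minimum is finite
   or not. *)
  have [e_ge|e_lt] := leP 1 eps.
    apply: (@le_trans _ _ 0%E); last by rewrite lee_fin.
    by rewrite mule_le0_ge0 ?Phi_ge0 // lee_fin; lra.
  have hPhi : (Phi k n p (eta + eps) <= (\sum_(i < n) rel_ent p (q i))%:E)%E.
    apply: Phi_le => //; rewrite mean_AP_cst // mean_AP_edges.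
    by apply: le_trans hq _; rewrite ler_wpM2r // lerD2l.
  apply: (@le_trans _ _ ((1 - eps)%:E * (\sum_(i < n) rel_ent p (q i))%:E)%E).
    by apply: lee_wpmul2l => //; rewrite lee_fin; lra.
  rewrite -EFinM lee_fin; apply: le_trans lq; rewrite ler_wpM2r //; lra.
have e10 : 0 < 1 + eps by lra.
have -> : - ln (lower_tail k n p eta) = (1 + eps) * (- ln (lower_tail k n p eta) / (1 + eps)).
  by field; rewrite gt_eqF.
rewrite EFinM; apply: lee_wpmul2l; first by rewrite lee_fin ltW.
apply: le_ereal_inf_tmp => _ [q [vq hq] <-]; rewrite lee_fin ler_pdivrMr // mulrC.
rewrite mean_AP_cst // mean_AP_edges in hq.
have S0 : 0 <= \sum_i rel_ent p (q i) by apply: sumr_ge0 => i _; exact: rel_ent_ge0.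
have := upp n (AP_sets k n) p eta (@unif) (@codeg) n0 cE hp pp0 ltac:(lra) heta q vq.
rewrite -lt_eq => h; apply: (le_trans (h _)).
  apply: le_trans hq _; rewrite ler_wpM2r // ler_wpM2r //; last lra.
  by case/andP: heta.
by rewrite ler_wpM2r //; lra.
Qed.
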